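(* Let $\mathcal{F}_\lambda=\{f_j^\lambda(x)=r_j(\lambda)x+a_j(\lambda)\}_{j\in\mathcal{A}}$, $\lambda\in\overline{U}$, with $r_j(\lambda)\in(0,1)$ and $a_j(\lambda)\in\mathbb{R}$, be a family of non-degenerate self-similar IFS on $X$ satisfying the smoothness assumptions (A1)–(A4) and the transversality condition (T) on $U$. Then the natural self-similar measure $\nu_\lambda$ of $\mathcal{F}_\lambda$ is absolutely continuous with a density in $L^2$ for Lebesgue almost every $\lambda\in U$ such that the similarity dimension of $\mathcal{F}_\lambda$ is strictly greater than $1$.
   Context: Let $\mathcal{A}=\{1,\dots,m\}$, let $U\subset\mathbb{R}$ be a bounded open interval with closure $\overline{U}$, let $X\subset\mathbb{R}$ be a compact interval with $\operatorname{diam}(X)=1$, and for each $\lambda\in\overline{U}$ let $f_j^\lambda:X\to X$, $j\in\mathcal{A}$. The smoothness assumptions, for some fixed $\delta\in(0,1]$, are: (A1) the maps $f_j^\lambda$ are $C^{2+\delta}$ on $X$ with $M_1=\sup_{\lambda\in U}\sup_{j}\|\frac{d^2}{dx^2}f_j^\lambda\|_\infty<\infty$ and there are $C_1,C_2>0$ with $|\frac{d^2}{dx^2}f_j^\lambda(x)-\frac{d^2}{dx^2}f_j^\lambda(y)|\le C_1|x-y|^\delta$ and $|\frac{d^2}{dx^2}f_j^{\lambda_1}(x)-\frac{d^2}{dx^2}f_j^{\lambda_2}(x)|\le C_2|\lambda_1-\lambda_2|^\delta$ for all $x,y\in X$, $j\in\mathcal{A}$, $\lambda,\lambda_1,\lambda_2\in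 U$; (A2) the maps $\lambda\mapsto f_j^\lambda(x)$ are $C^{1+\delta}$ on $U$ and there is $C_3>0$ with $|\frac{d}{d\lambda}f_j^{\lambda_1}(x)-\frac{d}{d\lambda}f_j^{\lambda_2}(x)|\le C_3|\lambda_1-\lambda_2|^\delta$ for all $x\in X$, $j\in\mathcal{A}$, $\lambda_1,\lambda_2\in U$; (A3) the second partial derivatives $\frac{d^2}{dx\,d\lambda}f_j^\lambda(x)$, $\frac{d^2}{d\lambda\,dx}f_j^\lambda(x)$ exist and are continuous on $U\times X$ (hence equal), with $M_2=\sup_j\sup_{\lambda\in U}\|\frac{d^2}{d\lambda\,dx}f_j^\lambda\|_\infty<\infty$, and there are $C_4,C_5>0$ with $|\frac{d^2}{dx\,d\lambda}f_j^{\lambda}(x)-\frac{d^2}{dx\,d\lambda}f_j^{\lambda}(y)|\le C_4|x-y|^\delta$ and $|\frac{d^2}{dx\,d\lambda}f_j^{\lambda_1}(x)-\frac{d^2}{dx\,d\lambda}f_j^{\lambda_2}(x)|\le C_5|\lambda_1-\lambda_2|^\delta$ for all $x,y\in X$, $j\in\mathcal{A}$, $\lambda,\lambda_1,\lambda_2\in U$; (A4) there are $\gamma_1,\gamma_2>0$ with $0<\gamma_1\le|\frac{d}{dx}f_j^\lambda(x)|\le\gamma_2<1$ for all $j\in\mathcal{A}$, $x\in X$, $\lambda\in\overline{U}$. Let $\Omega=\mathcal{A}^{\mathbb{N}}$. The natural projection is $\Pi^\lambda(\omega)=\lim_{n\to\infty}f^\lambda_{\omega_1}\circ\cdots\circ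 f^\lambda_{\omega_n}(x_0)$ (independent of $x_0\in X$). (T) There exists $\eta>0$ such that for all $\lambda\in U$ and all $u,v\in\Omega$ with $u_1\ne v_1$: $|\Pi^\lambda(u)-\Pi^\lambda(v)|<\eta$ implies $|\frac{d}{d\lambda}(\Pi^\lambda(u)-\Pi^\lambda(v))|\ge\eta$. A self-similar IFS $\mathcal{F}=\{f_j(x)=r_jx+a_j\}_{j\in\mathcal{A}}$ is non-degenerate if the fixed points of the $f_j$ are all distinct. Its similarity dimension is the number $s=s(\mathcal{F})$ with $\sum_{j\in\mathcal{A}}r_j^s=1$. The natural self-similar measure is $\nu_{\mathcal{F}}=\Pi_*(\mathbf{p}^{\mathbb{N}})$, where $\mathbf{p}=(r_1^s,\dots,r_m^s)$, $\mathbf{p}^{\mathbb{N}}$ is the corresponding Bernoulli product measure on $\Omega$, and $\Pi$ is the natural projection of $\mathcal{F}$. *)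

(* Defs.v *)
From HB Require Import structures.
From mathcomp Require Import all_boot all_order all_algebra.
From mathcomp Require Import all_classical all_reals all_analysis.
From mathcomp Require Import ring lra.

Set Implicit Arguments.
Unset Strict Implicit.
Unset Printing Implicit Defensive.
Import Order.TTheory GRing.Theory Num.Theory.
Import numFieldNormedType.Exports.
Local Open Scope classical_set_scope.
Local Open Scope ring_scope.

(* The alphabet is 'I_m.+1, so that it is never empty; letters and positions
   are numbered from 0.  Measurable types are pointed in the library, whence
   the following instance. *)
HB.instance Definition _ m := isPointed.Build 'I_m.+1 ord0.

Definition cylinder (m : nat) (w : seq 'I_m.+1) : set (nat -> 'I_m.+1) :=
  [set u | mkseq u (size w) = w].

Definition cylinders (m : nat) : set (set (nat -> 'I_m.+1)) :=
  range (@cylinder m).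

(* Infinite words, with the product sigma-algebra of the discrete alphabet. *)
Notation Omega m := (g_sigma_algebraType (@cylinders m)).

(* The Bernoulli measure p^N is the one probability measure with these values
   on cylinders: see bernoulli_exists and bernoulli_unique. *)
Definition is_bernoulli (R : realType) (m : nat) (p : 'I_m.+1 -> R)
    (P : probability (Omega m) R) : Prop :=
  forall w, P (cylinder w) = (\prod_(j <- w) p j)%:E.

Lemma cylinder_nil m : cylinder [::] = [set: nat -> 'I_m.+1].
Proof. by rewrite eqEsubset; split. Qed.

Lemma cylinderP m (w : seq 'I_m.+1) u :
  cylinder w u <-> forall i, (i < size w)%N -> u i = nth ord0 w i.
Proof.
split=> [<- i|uw]; first by rewrite size_mkseq => iw; rewrite nth_mkseq.
apply: (@eq_from_nth _ ord0); rewrite size_mkseq// => i iw.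
by rewrite nth_mkseq// uw.
Qed.

(* Two cylinders intersect in a cylinder or not at all, hence the empty set. *)
Lemma cylinders0_setI m : setI_closed (set0 |` @cylinders m).
Proof.
suff cylI w w' : (size w <= size w')%N ->
    (set0 |` @cylinders m) (cylinder w `&` cylinder w').
  move=> _ _ [->|[w _ <-]] [->|[w' _ <-]]; rewrite ?(set0I, setI0); try by left.
  have [|/ltnW] := leqP (size w) (size w'); first exact: cylI.
  by rewrite setIC; exact: cylI.
move=> ww'.
have [[u [uw uw']]|noinh] := pselect (cylinder w `&` cylinder w' !=set0).
  right; exists w' => //; rewrite eqEsubset; split => [v vw'|v []//].
  split=> //; apply/cylinderP => i iw.
  move/cylinderP : vw' => -> //; last exact: leq_trans ww'.
  move/cylinderP : uw => <- //; move/cylinderP : uw' => -> //.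
  exact: leq_trans ww'.
by left; apply: contrapT => /eqP/set0P.
Qed.

Lemma bernoulli_unique (R : realType) (m : nat) (p : 'I_m.+1 -> R)
    (P Q : probability (Omega m) R) :
  is_bernoulli p P -> is_bernoulli p Q ->
  forall A : set (Omega m), measurable A -> P A = Q A.
Proof.
move=> hP hQ A mA.
apply: (@measure_unique _ R (Omega m) (set0 |` @cylinders m)
  (fun=> [set: Omega m])) => //.
- apply/seteqP; split.
    by apply: sub_sigma_algebra2; exact: subsetUr.
  apply: smallest_sub; first exact: smallest_sigma_algebra.
  move=> B [->|cylB]; first exact: sigma_algebra0.
  exact: sub_sigma_algebra.
- exact: cylinders0_setI.
- by move=> _; right; exists [::] => //; rewrite cylinder_nil.
- by rewrite bigcup_const.
- by move=> B [->|[w _ <-]]; [rewrite !measure0|rewrite [LHS]hP [RHS]hQ].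
- by move=> _; rewrite [X in (X < _)%E](@probability_setT _ (Omega m) _ P) ltry.
Qed.

(* Existence: expand a uniform point of [0, 1[ in the "base" p. *)
Section coding.
Variables (R : realType) (m : nat) (p : 'I_m.+1 -> R).
Hypotheses (p0 : forall j, 0 <= p j) (p1 : \sum_j p j = 1).

Let c (j : nat) : R := \sum_(i < m.+1 | (i < j)%N) p i.

Let c0 j : 0 <= c j.
Proof. by rewrite sumr_ge0. Qed.

Let cS (j : 'I_m.+1) : c j.+1 = c j + p j.
Proof.
rewrite /c (bigD1 j)//= addrC; congr (_ + _); apply: eq_bigl => i.
by rewrite ltnS andbC -(inj_eq val_inj)/= -ltn_neqAle.
Qed.

Let c_mono i j : (i <= j)%N -> c i <= c j.
Proof.
move=> ij; rewrite /c [leRHS](bigID (fun k : 'I_m.+1 => (k < i)%N))/=.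
rewrite [X in _ <= X + _](eq_bigl (fun k : 'I_m.+1 => (k < i)%N)); last first.
  by move=> k; rewrite andbC; case: ltnP => //= ki; rewrite (leq_trans ki).
by rewrite lerDl sumr_ge0.
Qed.

Let c_max : c m.+1 = 1.
Proof. by rewrite -p1; apply: eq_bigl => i; rewrite ltn_ord. Qed.

Let incell (x : R) (j : 'I_m.+1) := c j <= x < c j + p j.

Let incell_inj x i j : incell x i -> incell x j -> i = j.
Proof.
suff aux (k l : 'I_m.+1) : (k < l)%N -> incell x k -> incell x l -> False.
  move=> xi xj; apply/val_inj; case: (ltngtP i j) => // ij.
    by have := aux _ _ ij xi xj.
  by have := aux _ _ ij xj xi.
move=> kl /andP[_]; rewrite -cS => xk /andP[xl _].
by have := lt_le_trans xk (le_trans (c_mono kl) xl); rewrite ltxx.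
Qed.

Let incell_ex x : 0 <= x < 1 -> exists j, incell x j.
Proof.
move=> /andP[x0 x1].
have ex : exists n, (x < c n) && (n <= m.+1)%N.
  by exists m.+1; rewrite c_max x1 leqnn.
case: (ex_minnP ex) => -[|n] /andP[xn nm] nmin.
  by move: xn; rewrite /c big_pred0// ltNge x0.
exists (Ordinal nm); rewrite /incell -cS xn andbT leNgt.
by apply/negP => xn'; have := nmin n; rewrite xn' (ltnW nm) ltnn => /(_ isT).
Qed.

Let digit (x : R) : 'I_m.+1 := odflt ord0 [pick j | incell x j].

Let digitE x j : 0 <= x < 1 -> (digit x == j) = incell x j.
Proof.
move=> x01; rewrite /digit; case: pickP => [k xk|nox]/=.
  by apply/eqP/idP => [<-//|xj]; exact: incell_inj xk xj.
by have [k] := incell_ex x01; rewrite nox.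
Qed.

Let shift (x : R) := (x - c (digit x)) / p (digit x).

Let shift01 x : 0 <= x < 1 -> 0 <= shift x < 1.
Proof.
move=> x01; have : incell x (digit x) by rewrite -digitE.
move=> /andP[cx xc]; have p_gt0 : 0 < p (digit x) by lra.
rewrite /shift divr_ge0 ?subr_ge0 ?(ltW p_gt0)//=.
by rewrite ltr_pdivrMr// mul1r ltrBlDl.
Qed.

Let code (x : R) : Omega m := fun n => digit (iter n shift x).

Let lft (w : seq 'I_m.+1) := foldr (fun (j : 'I_m.+1) l => c j + p j * l) 0 w.
Let len (w : seq 'I_m.+1) := \prod_(j <- w) p j.

Let lft_len w : [/\ 0 <= lft w, 0 <= len w & lft w + len w <= 1].
Proof.
rewrite /len; elim: w => [|j w [l0 n0 ln1]] /=; first by rewrite big_nil; split; lra.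
rewrite big_cons; have := c0 j; have := p0 j.
have cp1 : c j + p j <= 1 by rewrite -cS -c_max; exact: c_mono.
by move=> pj cj; split; nra.
Qed.

Let code_cylinder w x : 0 <= x < 1 ->
  (mkseq (code x) (size w) == w) = (lft w <= x < lft w + len w).
Proof.
rewrite /len; elim: w x => [|j w IH] x x01.
  by rewrite big_nil /= add0r x01 eqxx.
have -> : mkseq (code x) (size (j :: w)) =
    digit x :: mkseq (code (shift x)) (size w).
  rewrite /mkseq /= -[1%N]add1n iotaDl -map_comp; congr (_ :: _).
  by apply: eq_map => n /=; rewrite /code -iterSr.
rewrite eqseq_cons IH ?shift01// big_cons.
have [l0 n0 ln1] := lft_len w; rewrite /len in n0 ln1.
have pj := p0 j.
apply/andP/andP => -[].
  rewrite /shift => /[dup] xj' /eqP <- /andP[].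
  move: xj'; rewrite digitE// => xj; have /eqP jE : digit x == j by rewrite digitE.
  rewrite /= !jE; case/andP : xj => cx xc.
  have pj0 : 0 < p j by lra.
  by rewrite ler_pdivlMr// ltr_pdivrMr// => h1 h2; split; nra.
rewrite /= => h1 h2; have xj : incell x j.
  by rewrite /incell; apply/andP; split; nra.
have jE : digit x = j by apply/eqP; rewrite digitE.
split; first exact/eqP.
rewrite /shift jE; case/andP : xj => cx xc; have pj0 : 0 < p j by lra.
by rewrite ler_pdivlMr// ltr_pdivrMr//; apply/andP; split; nra.
Qed.

Let I01 : set R := [set` `[0, 1[ ].
Let mI01 : measurable I01. Proof. exact: measurable_itv. Qed.

Let code1 (x : R) : Omega m := if x \in I01 then code x else fun=> ord0.

Let code1_cylinder w :
  code1 @^-1` (cylinder w) `&` I01 = [set` `[lft w, lft w + len w[ ].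
Proof.
have [l0 n0 ln1] := lft_len w.
rewrite eqEsubset; split=> x /=; rewrite in_itv/=.
  move=> []; rewrite /code1 => + x01; rewrite mem_set//.
  by move: x01; rewrite /I01/= in_itv/= => x01 /eqP; rewrite code_cylinder.
move=> xw; have x01 : 0 <= x < 1 by case/andP : xw => ? ?; apply/andP; split; lra.
have Ix : I01 x by rewrite /I01/= in_itv.
by split=> //; rewrite /code1 mem_set//; apply/eqP; rewrite code_cylinder.
Qed.

Let mcode1 : measurable_fun setT (code1 : measurableTypeR R -> Omega m).
Proof.
apply: (@measurability _ _ (measurableTypeR R) (Omega m) setT code1 (@cylinders m)) => //.
move=> _ [_ [w _ <-] <-]; rewrite setTI.
rewrite -(setUIDK (code1 @^-1` cylinder w) I01) code1_cylinder.
apply: measurableU; first exact: measurable_itv.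
have [w0|w0] := pselect (cylinder w (fun=> ord0)).
  suff -> : code1 @^-1` cylinder w `\` I01 = ~` I01 by exact: measurableC.
  rewrite eqEsubset; split=> x /=; first by case.
  by move=> nx; split=> //; rewrite /code1 memNset.
suff -> : code1 @^-1` cylinder w `\` I01 = set0 by [].
by rewrite -subset0 => x [] /=; rewrite /code1 => + nx; rewrite memNset.
Qed.

Lemma bernoulli_exists : exists P : probability (Omega m) R, is_bernoulli p P.
Proof.
pose mu := measure_function_pushforward__canonical__measure_function_Measure
  (mrestr lebesgue_measure mI01) mcode1.
have muE w : mu (cylinder w) = (len w)%:E.
  rewrite /= /pushforward /mrestr code1_cylinder lebesgue_measure_itv/= lte_fin.
  have [l0 n0 ln1] := lft_len w.
  have := n0; rewrite le_eqVlt => /predU1P[<-|n0'].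
    by rewrite addr0 ltxx.
  by rewrite ltrDl n0' -EFinB addrC addKr.
have mu1 : mu [set: Omega m] = 1%E.
  by rewrite -[X in mu X](@cylinder_nil m) muE /len big_nil.
exists (mnormalize mu point) => w.
by rewrite /= /mnormalize mu1 /= onee_eq0 /= invr1 mule1 muE.
Qed.
End coding.

Definition nat_proj (R : realType) (m : nat) (f : 'I_m.+1 -> R -> R) (x0 : R)
    (u : Omega m) : R :=
  lim ((fun n => foldr (fun k x => f (u k) x) x0 (iota 0 n)) @ \oo).

(* Derivative at [x] of a function on [A], one-sided at the end points when [A]
   is a closed interval. *)
Definition derivable_in (R : realType) (A : set R) (g : R -> R) (x : R) : Prop :=
  cvg ((g y - g x) / (y - x) @[y --> within A x^']).

Definition derive_in (R : realType) (A : set R) (g : R -> R) (x : R) : R :=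
  lim ((g y - g x) / (y - x) @[y --> within A x^']).

Definition hoelder_on (R : realType) (delta : R) (A : set R) (g : R -> R) : Prop :=
  exists2 C, 0 < C &
    forall x y, A x -> A y -> `|g x - g y| <= C * `|x - y| `^ delta.

(* A family of maps is [f : R -> 'I_m.+1 -> R -> R], with [f l j] the map of
   index [j] at the parameter [l]. *)
Section smoothness.
Variables (R : realType) (m : nat) (delta : R) (U X : set R).
Variable f : R -> 'I_m.+1 -> R -> R.

Definition d_x l j x := derive_in X (f l j) x.
Definition d_xx l j x := derive_in X (d_x l j) x.
Definition d_l l j x := derive1 (fun k => f k j x) l.
Definition d_x_d_l l j x := derive_in X (d_l l j) x.
Definition d_l_d_x l j x := derive1 (fun k => d_x k j x) l.

Definition smooth_space : Prop :=
  [/\ forall l j, closure U l ->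
        [/\ forall x, X x -> derivable_in X (f l j) x,
            forall x, X x -> derivable_in X (d_x l j) x &
            hoelder_on delta X (d_xx l j)],
      exists M, forall l j x, U l -> X x -> `|d_xx l j x| <= M,
      exists2 C1, 0 < C1 & forall l j x y, U l -> X x -> X y ->
        `|d_xx l j x - d_xx l j y| <= C1 * `|x - y| `^ delta &
      exists2 C2, 0 < C2 & forall l1 l2 j x, U l1 -> U l2 -> X x ->
        `|d_xx l1 j x - d_xx l2 j x| <= C2 * `|l1 - l2| `^ delta].

Definition smooth_parameter : Prop :=
  (forall j x, X x ->
     (forall l, U l -> derivable (fun k => f k j x) l 1) /\
     hoelder_on delta U (fun l => d_l l j x)) /\
  exists2 C3, 0 < C3 & forall l1 l2 j x, U l1 -> U l2 -> X x ->
    `|d_l l1 j x - d_l l2 j x| <= C3 * `|l1 - l2| `^ delta.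

Definition smooth_mixed : Prop :=
  [/\ forall l j x, U l -> X x ->
        derivable_in X (d_l l j) x /\ derivable (fun k => d_x k j x) l 1,
      forall j,
        {within U `*` X, continuous (fun z : R * R => d_x_d_l z.1 j z.2)} /\
        {within U `*` X, continuous (fun z : R * R => d_l_d_x z.1 j z.2)},
      exists M, forall l j x, U l -> X x -> `|d_l_d_x l j x| <= M,
      exists2 C4, 0 < C4 & forall l j x y, U l -> X x -> X y ->
        `|d_x_d_l l j x - d_x_d_l l j y| <= C4 * `|x - y| `^ delta &
      exists2 C5, 0 < C5 & forall l1 l2 j x, U l1 -> U l2 -> X x ->
        `|d_x_d_l l1 j x - d_x_d_l l2 j x| <= C5 * `|l1 - l2| `^ delta].

Definition hyperbolic : Prop :=
  exists g1 g2, [/\ 0 < g1, 0 < g2, g2 < 1 &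
    forall l j x, closure U l -> X x -> g1 <= `|d_x l j x| <= g2].

Definition transversality (x0 : R) : Prop :=
  exists2 eta, 0 < eta & forall l (u v : Omega m), U l -> u 0%N <> v 0%N ->
    `|nat_proj (f l) x0 u - nat_proj (f l) x0 v| < eta ->
    eta <= `|derive1 (fun k => nat_proj (f k) x0 u - nat_proj (f k) x0 v) l|.

End smoothness.

Definition affine_ifs (R : realType) (m : nat) (r a : 'I_m.+1 -> R)
    : 'I_m.+1 -> R -> R :=
  fun j x => r j * x + a j.

Definition distinct_fixpoints (R : realType) (m : nat) (f : 'I_m.+1 -> R -> R) : Prop :=
  forall i j x, f i x = x -> f j x = x -> i = j.

(* The similarity dimension; the default value 0 is never used when the ratios
   are in ]0, 1[, see sim_dimP and sim_dim_unique. *)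
Definition sim_dim (R : realType) (m : nat) (r : 'I_m.+1 -> R) : R :=
  xget 0 [set s | \sum_j r j `^ s = 1].

Section sim_dim_theory.
Variables (R : realType) (m : nat) (r : 'I_m.+1 -> R).
Hypothesis r01 : forall j, 0 < r j < 1.

Let ltr_powR_sum s t : s < t -> \sum_j r j `^ t < \sum_j r j `^ s.
Proof.
move=> st; apply: ltr_sum; first by apply/hasP; exists ord0; rewrite ?mem_index_enum.
move=> j _; have /andP[r0 r1] := r01 j.
by rewrite /powR gt_eqF// ltr_expR ltr_nM2r// ln_lt0// r0.
Qed.

Let ex_sim_dim : exists s, \sum_j r j `^ s = 1.
Proof.
pose g s := \sum_j r j `^ s.
have cg : continuous g.
  have -> : g = \sum_j (fun s => r j `^ s).
    by apply/funext => s; rewrite fct_sumE.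
  elim/big_ind : _ => [|f h cf ch|j _]; first exact: cst_continuous.
    by move=> x; apply: cvgD; [exact: cf|exact: ch].
  have /andP[r0 _] := r01 j.
  move=> x; rewrite (_ : (fun s => _) = (fun s => expR (s * ln (r j)))).
    apply: continuous_comp; last exact: continuous_expR.
    exact: mulrr_continuous.
  by apply/funext => s; rewrite /powR gt_eqF.
pose L := ln (m.+1%:R : R).
have L0 : 0 <= L by rewrite ln_ge0// ler1n.
pose S := \sum_j L / - ln (r j).
have nlr j : 0 < - ln (r j) by rewrite oppr_gt0 ln_lt0.
have S0 : 0 <= S by apply: sumr_ge0 => j _; rewrite divr_ge0// ltW.
have gS : g S <= 1.
  have <- : \sum_(j < m.+1) (m.+1%:R^-1 : R) = 1.
    by rewrite sumr_const card_ord -[LHS]mulr_natr mulVf// pnatr_eq0.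
  apply: ler_sum => j _; have /andP[r0 r1] := r01 j.
  rewrite /powR gt_eqF// -[leRHS]lnK ?posrE ?invr_gt0// ler_expR lnV ?posrE//.
  rewrite -/L lerNr -mulrN -ler_pdivrMr// /S (bigD1 j)//= lerDl.
  by apply: sumr_ge0 => i _; rewrite divr_ge0// ltW.
have g0 : 1 <= g 0.
  by rewrite /g (eq_bigr (fun=> 1)) ?sumr_const ?card_ord ?ler1n// => j _; rewrite powRr0.
have [||s _ gs] := @IVT R g 0 S 1 S0; last by exists s.
  by apply: continuous_subspaceT.
by rewrite ge_min le_max gS g0 orbT.
Qed.

Lemma sim_dimP : \sum_j r j `^ sim_dim r = 1.
Proof. by rewrite /sim_dim; case: xgetP => //; case: ex_sim_dim => s + /(_ s). Qed.

Lemma sim_dim_unique s : \sum_j r j `^ s = 1 -> s = sim_dim r.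
Proof.
move=> hs; apply/eqP; rewrite eq_le; apply/andP; split; rewrite leNgt;
  by apply/negP => /ltr_powR_sum; rewrite hs sim_dimP ltxx.
Qed.

End sim_dim_theory.

(* [nu] is the image of the Bernoulli measure with weights [r j `^ s], where [s]
   is the similarity dimension, under the natural projection. *)
Definition is_natural_measure (R : realType) (m : nat) (r a : 'I_m.+1 -> R)
    (x0 : R) (nu : set R -> \bar R) : Prop :=
  exists2 P : probability (Omega m) R,
    is_bernoulli (fun j => r j `^ sim_dim r) P &
    nu = pushforward P (nat_proj (affine_ifs r a) x0).

Definition has_L2_density (R : realType) (nu : set R -> \bar R) : Prop :=
  exists g : R -> R, [/\ g \in Lfun lebesgue_measure 2%:E,
    forall x, 0 <= g x &
    forall A : set R, measurable A ->
      nu A = (\int[lebesgue_measure]_(x in A) (g x)%:E)%E].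

(* Main.v *)
Require Import Defs.
From mathcomp Require Import all_boot all_order all_algebra.
From mathcomp Require Import all_classical all_reals all_analysis.
From mathcomp Require Import measurable_realfun.
From mathcomp Require Import ring lra.

Set Implicit Arguments.
Unset Strict Implicit.
Unset Printing Implicit Defensive.
Import Order.TTheory GRing.Theory Num.Theory.
Import numFieldNormedType.Exports.
Local Open Scope classical_set_scope.
Local Open Scope ring_scope.

(** Write [p_j = r_j `^ s] for the natural weights, [s] being the similarity
    dimension, and [Pi_l w] for the image of [x0] under the composition of the
    maps indexed by the word [w]. At level [n] the natural measure is, up to a
    displacement of [q ^+ n], the sum of point masses [p_l w] at [Pi_l w], where
    [q < 1] bounds the ratios. Its smoothing at scale [q ^+ n] has a square
    integral controlled by [overlap n t / t], [t = 4 * q ^+ n], the overlap being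
    the weight of the pairs of words of length [n] whose points are [t]-close. If
    this stays bounded along a sequence of [n], the measure has an L2 density
    ([overlap_L2_density]): it is absolutely continuous because an open set [G]
    has mass at most [eps * C + |G| / eps], and its density, being almost
    everywhere a limit of averages, is square integrable by Fatou's lemma. By
    Fatou's lemma again, now in the parameter ([ae_frequently_le]), it suffices
    to bound the integral of [overlap n t] over a small interval [J] of
    parameters by a constant times [t], which is [overlap_int].

    For words with different first letters, transversality and the mean value
    theorem show that the parameters where the pair is [t]-close lie within
    O([t]) of each other ([transversal_separation]). The difficulty is that the
    weights also depend on the parameter: bounding them by their suprema over [J]
    would cost a factor exponential in [n]. But when words are lengthened by a
    letter, only the parameters where the shorter words were already close
    matter. These form a set of diameter O([q ^+ n]), over which the weight of the
    new letter varies by a factor [1 + O(q ^+ n)] because the logarithms of the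
    weights are Lipschitz ([natural_weight_lipschitz]). Since the weights of a
    letter sum to 1 at every parameter, the total of the largest relevant weights
    is multiplied by [1 + O(q ^+ n)] at most from one length to the next, and the
    product of these factors converges ([overlap_majorant]).

    A common first letter [j] contributes a factor [p_j ^+ 2] and divides the
    scale by [r_j]. When [s > 1], the sum of the [p_j ^+ 2 / r_j] is less than 1
    ([energy_lt1]), so the contributions of the common prefixes form a convergent
    geometric series. *)

(** * Words, and the weights and maps they index *)

Section words.
Variable m : nat.
Implicit Types (w v : seq 'I_m.+1) (n k : nat).

Fixpoint words n : seq (seq 'I_m.+1) :=
  if n is n'.+1 then [seq j :: w | j <- index_enum 'I_m.+1, w <- words n']
  else [:: [::]].

Lemma size_words n w : w \in words n -> size w = n.
Proof.
elim: n w => [|n IH] w /=; first by rewrite inE => /eqP ->.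
by move=> /allpairsP[[j v] /= [_ vn ->]] /=; rewrite (IH v).
Qed.

Lemma mem_words w : w \in words (size w).
Proof.
elim: w => //= j w IH; apply/allpairsP; exists (j, w) => /=; split=> //.
exact: mem_index_enum.
Qed.

Variable V : nmodType.
Implicit Type F : seq 'I_m.+1 -> V.

Lemma sum_words_cons n F :
  \sum_(w <- words n.+1) F w = \sum_j \sum_(w <- words n) F (j :: w).
Proof. by rewrite /= big_allpairs_dep. Qed.

Lemma sum_words_cat n k F : \sum_(w <- words (n + k)) F w =
  \sum_(w <- words n) \sum_(v <- words k) F (w ++ v).
Proof.
elim: n F => [|n IH] F; first by rewrite add0n /= big_seq1.
rewrite addSn !sum_words_cons; apply: eq_bigr => j _.
exact: (IH (fun w => F (j :: w))).
Qed.

End words.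

Section weights.
Variables (R : realType) (m : nat).
Implicit Types (p r a : 'I_m.+1 -> R) (w v : seq 'I_m.+1).

Definition weight p w := \prod_(j <- w) p j.

Lemma weight_ge0 p w : (forall j, 0 <= p j) -> 0 <= weight p w.
Proof. by move=> p0; rewrite prodr_ge0. Qed.

Lemma weight_cat p w v : weight p (w ++ v) = weight p w * weight p v.
Proof. exact: big_cat. Qed.

Lemma sum_weight p n : \sum_j p j = 1 -> \sum_(w <- words m n) weight p w = 1.
Proof.
move=> p1; elim: n => [|n IH]; first by rewrite big_seq1 /weight big_nil.
rewrite sum_words_cons -[RHS]p1; apply: eq_bigr => j _.
by rewrite -[RHS]mulr1 -IH mulr_sumr; apply: eq_bigr => w _; rewrite /weight big_cons.
Qed.

Definition apply_word r a x w := foldr (affine_ifs r a) x w.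

Lemma apply_wordB r a x y w :
  apply_word r a x w - apply_word r a y w = weight r w * (x - y).
Proof.
elim: w => [|j w IH]; first by rewrite /weight big_nil mul1r.
rewrite /weight big_cons -mulrA -IH /apply_word /= /affine_ifs; ring.
Qed.

Lemma apply_word_in (X : set R) r a x w :
  (forall j y, X y -> X (affine_ifs r a j y)) -> X x -> X (apply_word r a x w).
Proof. by move=> XX Xx; elim: w => //= j w IH; apply: XX. Qed.

Lemma weight_le r q w : (forall j, 0 <= r j <= q) -> weight r w <= q ^+ size w.
Proof.
move=> rq; elim: w => [|j w IH]; first by rewrite /weight big_nil.
have /andP[r0 rq'] := rq j.
rewrite /weight big_cons exprS ler_pM//.
by apply: weight_ge0 => i; case/andP: (rq i).
Qed.

End weights.

(** * Bounding integrals over the parameter through majorants *)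

Section integral_bound.
Variable R : realType.
Local Notation mu := (@lebesgue_measure R).
Implicit Types (J : set R) (F G : R -> R).

(** An upper bound for the upper integral of [F] over [J]: with a majorant [H],
    no measurability of [F] in the parameter ever has to be established. *)
Definition int_bounded J F (c : R) := exists H : R -> \bar R,
  [/\ measurable_fun J H, forall x, J x -> (0 <= H x)%E,
      forall x, J x -> ((F x)%:E <= H x)%E & (\int[mu]_(x in J) H x <= c%:E)%E].

Lemma int_boundedW J F G c d : int_bounded J G c -> c <= d ->
  (forall x, J x -> F x <= G x) -> int_bounded J F d.
Proof.
move=> [H [mH H0 GH Hc]] cd FG; exists H; split => //.
  by move=> x Jx; rewrite (le_trans _ (GH x Jx))// lee_fin FG.
by rewrite (le_trans Hc)// lee_fin.
Qed.

Lemma int_bounded0 J : int_bounded J (fun=> 0) 0.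
Proof.
exists (cst 0%E); split => //.
by rewrite integral0.
Qed.

Lemma int_boundedD J F G c d : measurable J -> int_bounded J F c ->
  int_bounded J G d -> int_bounded J (F \+ G) (c + d).
Proof.
move=> mJ [H [mH H0 FH Hc]] [K [mK K0 GK Kd]]; exists (H \+ K)%E; split.
- exact: emeasurable_funD.
- by move=> x Jx; rewrite adde_ge0 ?H0 ?K0.
- by move=> x Jx; rewrite EFinD leeD ?FH ?GK.
- by rewrite ge0_integralD// EFinD leeD.
Qed.

Lemma int_boundedZ J F c k : measurable J -> 0 <= k -> int_bounded J F c ->
  int_bounded J (fun x => k * F x) (k * c).
Proof.
move=> mJ k0 [H [mH H0 FH Hc]]; exists (fun x => k%:E * H x)%E; split.
- exact: measurable_funeM.
- by move=> x Jx; rewrite mule_ge0 ?lee_fin ?H0.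
- by move=> x Jx; rewrite EFinM lee_wpmul2l ?lee_fin ?FH.
- by rewrite ge0_integralZl ?lee_fin// EFinM lee_wpmul2l ?lee_fin.
Qed.

Lemma int_bounded_sum J (I : Type) (s : seq I) (P : pred I) (F : I -> R -> R)
    (c : I -> R) : measurable J ->
  (forall i, P i -> int_bounded J (F i) (c i)) ->
  int_bounded J (fun x => \sum_(i <- s | P i) F i x) (\sum_(i <- s | P i) c i).
Proof.
move=> mJ Fc; elim: s => [|i s IH].
  rewrite big_nil; apply: (int_boundedW (int_bounded0 J)) => // x _.
  by rewrite big_nil.
rewrite big_cons; case: ifP => Pi; last first.
  by apply: (int_boundedW IH) => // x _; rewrite big_cons Pi.
apply: (int_boundedW (int_boundedD mJ (Fc i Pi) IH)) => // x _.
by rewrite big_cons Pi.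
Qed.

Lemma int_bounded_cst J (c d : R) : measurable J -> (mu J <= d%:E)%E -> 0 <= c ->
  int_bounded J (fun=> c) (c * d).
Proof.
move=> mJ Jd c0; exists (cst c%:E); split => //.
by rewrite integral_cst// EFinM lee_wpmul2l.
Qed.

(** How transversality is used: a function that lives on a set of diameter [d]
    lives on an interval of length [2 * d]. *)
Lemma int_bounded_loc J F (c d : R) (Z : set R) : measurable J ->
  0 <= c -> 0 <= d ->
  (forall x, J x -> F x <= c * (x \in Z)%:R) ->
  (forall x y, J x -> J y -> Z x -> Z y -> `|x - y| <= d) ->
  int_bounded J F (c * (2 * d)).
Proof.
move=> mJ c0 d0 FZ Zd.
have [[z [Jz Zz]]|noz] := pselect (exists z, J z /\ Z z); last first.
  apply: (int_boundedW (int_bounded0 J)); first by rewrite !mulr_ge0.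
  move=> x Jx; rewrite (le_trans (FZ x Jx))// memNset ?mulr0// => Zx.
  by apply: noz; exists x.
pose B : set R := [set` `[z - d, z + d] ].
have mB : measurable B by exact: measurable_itv.
apply: (@int_boundedW _ _ (fun x => c * \1_B x) (c * (2 * d)) _ _ (lexx _)); last first.
  move=> x Jx; rewrite (le_trans (FZ x Jx))// ler_wpM2l//.
  case: (boolP (x \in Z)) => // /set_mem Zx; rewrite indicE mem_set//.
  rewrite /B/= in_itv/=; have := Zd _ _ Jx Jz Zx Zz.
  by rewrite ler_distl.
apply: int_boundedZ => //; exists (EFin \o \1_B); split => //.
- by apply/measurable_EFinP; apply: measurable_indic.
- by move=> x _; rewrite lee_fin indicE.
- rewrite [leLHS](_ : _ = \int[mu]_(x in J) (\1_B x)%:E)%E//.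
  rewrite integral_indic//; apply: (@le_trans _ _ (mu B)).
    by apply: le_measure; rewrite ?inE//; exact: measurableI.
  rewrite lebesgue_measure_itv/= lte_fin; case: ifP => _.
    by rewrite -EFinB lee_fin; lra.
  by rewrite lee_fin; lra.
Qed.

Lemma int_bounded_integral J F c : measurable J -> measurable_fun J F ->
  (forall x, J x -> 0 <= F x) -> int_bounded J F c ->
  (\int[mu]_(x in J) (F x)%:E <= c%:E)%E.
Proof.
move=> mJ mF F0 [H [mH H0 FH Hc]]; apply: le_trans Hc.
by apply: ge0_le_integral => //; exact/measurable_EFinP.
Qed.

End integral_bound.

(** * Weighted counts of pairs of close words *)

Section pair_sums.
Variables (R : realType) (m : nat).
Implicit Types (F G : seq 'I_m.+1 -> seq 'I_m.+1 -> R).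

Definition pair_sum n F := \sum_(w <- words m n) \sum_(w' <- words m n) F w w'.

Lemma ler_pair_sum n F G :
  (forall w w', size w = n -> size w' = n -> F w w' <= G w w') ->
  pair_sum n F <= pair_sum n G.
Proof.
move=> FG; rewrite /pair_sum !big_seq; apply: ler_sum => w /size_words wn.
by rewrite !big_seq; apply: ler_sum => w' /size_words w'n; exact: FG.
Qed.

Lemma eq_pair_sum n F G :
  (forall w w', size w = n -> size w' = n -> F w w' = G w w') ->
  pair_sum n F = pair_sum n G.
Proof.
by move=> FG; apply/eqP; rewrite eq_le !ler_pair_sum// => w w' wn w'n; rewrite FG.
Qed.

Lemma pair_sum_ge0 n F : (forall w w', 0 <= F w w') -> 0 <= pair_sum n F.
Proof. by move=> F0; apply: sumr_ge0 => w _; apply: sumr_ge0 => w' _. Qed.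

Lemma pair_sumZ n c F : pair_sum n (fun w w' => c * F w w') = c * pair_sum n F.
Proof.
by rewrite /pair_sum mulr_sumr; apply: eq_bigr => w _; rewrite mulr_sumr.
Qed.

Lemma pair_sumD n F G :
  pair_sum n (fun w w' => F w w' + G w w') = pair_sum n F + pair_sum n G.
Proof.
by rewrite /pair_sum -big_split; apply: eq_bigr => w _; rewrite -big_split.
Qed.

Lemma pair_sum_cat n k F : pair_sum (n + k) F =
  pair_sum n (fun w w' => pair_sum k (fun v v' => F (w ++ v) (w' ++ v'))).
Proof.
rewrite /pair_sum sum_words_cat; apply: eq_bigr => w _.
rewrite exchange_big /= sum_words_cat; apply: eq_bigr => w' _.
exact: exchange_big.
Qed.

Lemma pair_sum_cons n F : pair_sum n.+1 F =
  \sum_i \sum_j pair_sum n (fun w w' => F (i :: w) (j :: w')).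
Proof.
rewrite /pair_sum sum_words_cons; apply: eq_bigr => i _.
by rewrite [RHS]exchange_big /=; apply: eq_bigr => w _; rewrite sum_words_cons.
Qed.

Lemma pair_sum_weight n (p : 'I_m.+1 -> R) : \sum_j p j = 1 ->
  pair_sum n (fun w w' => weight p w * weight p w') = 1.
Proof.
move=> p1; rewrite /pair_sum -[RHS](sum_weight n p1); apply: eq_bigr => w _.
by rewrite -mulr_sumr sum_weight// mulr1.
Qed.

End pair_sums.

Definition heads_differ m (w w' : seq 'I_m.+1) := head ord0 w != head ord0 w'.

Section overlaps.
Variables (R : realType) (m : nat) (r a p : 'I_m.+1 -> R) (x0 : R).
Local Notation Pi := (apply_word r a x0).

Definition close_weight (t : R) (w w' : seq 'I_m.+1) :=
  weight p w * weight p w' * (`|Pi w - Pi w'| <= t)%R%:R.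

(** Up to discretization, [overlap n t] is the mass that the square of the
    self-similar measure gives to the band of half-width [t] around the
    diagonal; a bound of order [t] at [t = q ^+ n] is an L2 bound on the
    measure smoothed at scale [q ^+ n]. *)
Definition overlap n t := pair_sum n (close_weight t).

(** Transversality only speaks of words with different first letters. *)
Definition overlap_off n t :=
  pair_sum n (fun w w' => (heads_differ w w')%:R * close_weight t w w').

Hypotheses (p0 : forall j, 0 <= p j) (p1 : \sum_j p j = 1).

Lemma close_weight_ge0 t w w' : 0 <= close_weight t w w'.
Proof. by rewrite !mulr_ge0 ?weight_ge0. Qed.

Lemma overlap_off_le1 n t : overlap_off n t <= 1.
Proof.
rewrite -(pair_sum_weight n p1); apply: ler_pair_sum => w w' _ _.
have W0 : 0 <= weight p w * weight p w' by rewrite mulr_ge0 ?weight_ge0.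
rewrite /close_weight; case: heads_differ; rewrite ?mul0r// mul1r.
by rewrite ler_piMr// lern1 leq_b1.
Qed.

(** Forgetting the last [k] letters moves each point by at most [q ^+ n], and the
    weights of the forgotten endings sum to 1. *)
Lemma overlap_off_truncate q n k t : (0 < n)%N ->
  (forall w v, `|Pi (w ++ v) - Pi w| <= q ^+ size w) ->
  overlap_off (n + k) t <= overlap_off n (t + 2 * q ^+ n).
Proof.
move=> n0 Piq; rewrite /overlap_off pair_sum_cat; apply: ler_pair_sum => w w' wn w'n.
rewrite -[leRHS]mulr1 -[X in _ <= _ * X](pair_sum_weight k p1) -pair_sumZ.
apply: ler_pair_sum => v v' _ _.
have hc (s s' : seq 'I_m.+1) : size s = n -> head ord0 (s ++ s') = head ord0 s.
  by case: s => //= sn; move: n0; rewrite -sn.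
rewrite /heads_differ !hc// -[leRHS]mulrA; apply: ler_wpM2l => //.
rewrite /close_weight !weight_cat.
have V0 : 0 <= weight p v * weight p v' by rewrite mulr_ge0 ?weight_ge0.
have W0 : 0 <= weight p w * weight p w' by rewrite mulr_ge0 ?weight_ge0.
have -> : weight p w * weight p v * (weight p w' * weight p v') =
  weight p w * weight p w' * (weight p v * weight p v') by ring.
rewrite [leRHS]mulrAC ler_wpM2l ?(mulr_ge0 W0 V0)// ler_nat.
case: (lerP `|_| t) => //= h; rewrite lt0b.
have := Piq w v; have := Piq w' v'; rewrite wn w'n => h1 h2.
have -> : Pi w - Pi w' = (Pi (w ++ v) - Pi (w' ++ v')) - (Pi (w ++ v) - Pi w)
  + (Pi (w' ++ v') - Pi w') by ring.
by rewrite (le_trans (ler_normD _ _))// (le_trans (lerD (ler_normB _ _) (lexx _)))//; lra.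
Qed.

(** Self-similarity: two words with the same first letter [j] carry the common
    factor [p j ^+ 2] and their points are the images, under a map of ratio
    [r j], of the points of the two remaining words. *)
Lemma overlapS n t (pbar rlow : 'I_m.+1 -> R) :
  (forall j, p j <= pbar j) -> (forall j, 0 < rlow j <= r j) ->
  overlap n.+1 t <=
    overlap_off n.+1 t + \sum_j pbar j ^+ 2 * overlap n (t / rlow j).
Proof.
move=> ppbar rlowr.
rewrite /overlap /overlap_off [leLHS](_ : _ =
    pair_sum n.+1 (fun w w' => (heads_differ w w')%:R * close_weight t w w') +
    pair_sum n.+1 (fun w w' => (~~ heads_differ w w')%:R * close_weight t w w')).
  rewrite lerD2l pair_sum_cons; apply: ler_sum => i _.
  rewrite (bigD1 i)//= [X in _ + X]big1 ?addr0; last first.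
    move=> j ji; rewrite (eq_pair_sum (G := fun w w' => 0 * 0)) => [|w w' _ _].
      by rewrite pair_sumZ mul0r.
    by rewrite /heads_differ /= eq_sym ji /= !mul0r.
  rewrite -pair_sumZ; apply: ler_pair_sum => w w' _ _.
  rewrite /heads_differ /= eqxx /= mul1r /close_weight /weight !big_cons.
  rewrite -/(weight p w) -/(weight p w').
  have -> : p i * weight p w * (p i * weight p w') =
    p i ^+ 2 * (weight p w * weight p w') by ring.
  have W0 : 0 <= weight p w * weight p w' by rewrite mulr_ge0 ?weight_ge0.
  rewrite -mulrA; apply: ler_pM.
  - exact: sqr_ge0.
  - by rewrite mulr_ge0.
  - by rewrite lerXn2r ?nnegrE// (le_trans (p0 i)).
  rewrite ler_wpM2l// ler_nat.
  have /andP[rl0 rlr] := rlowr i.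
  rewrite ler_pdivlMr//.
  have -> : affine_ifs r a i (foldr (affine_ifs r a) x0 w) -
      affine_ifs r a i (foldr (affine_ifs r a) x0 w') = r i * (Pi w - Pi w').
    by rewrite /affine_ifs /apply_word; ring.
  rewrite normrM ger0_norm ?(le_trans (ltW rl0))//.
  case: (lerP (r i * _) t) => //= h; rewrite lt0b; apply: le_trans h.
  by rewrite mulrC ler_wpM2r.
rewrite -pair_sumD; apply: eq_pair_sum => w w' _ _.
by case: heads_differ => /=; rewrite mul1r mul0r ?addr0 ?add0r.
Qed.

End overlaps.

(** * The overlap integrated over a small interval of parameters *)

Section transversal_family.
Variables (R : realType) (m : nat) (J : set R) (r a p : R -> 'I_m.+1 -> R).
Variables (x0 q L S l0 : R).
Local Notation mu := (@lebesgue_measure R).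
Local Notation Pi l w := (apply_word (r l) (a l) x0 w).
Local Notation close l t w w' := (`|Pi l w - Pi l w'| <= t).

Hypotheses (mJ : measurable J) (muJ : (mu J <= 1%:E)%E) (Jl0 : J l0).
Hypotheses (p0 : forall l j, J l -> 0 <= p l j).
Hypothesis p1 : forall l, J l -> \sum_j p l j = 1.
Hypotheses (q0 : 0 < q) (q1 : q < 1) (L0 : 0 <= L) (S0 : 0 <= S).
Hypothesis Piq : forall l w v, J l -> `|Pi l (w ++ v) - Pi l w| <= q ^+ size w.
Hypothesis plip : forall l l' j, J l -> J l' ->
  p l j <= expR (L * `|l - l'|) * p l' j.
Hypothesis sep : forall n (w w' : seq 'I_m.+1) t l l', (0 < n)%N ->
  size w = n -> size w' = n -> heads_differ w w' -> q ^+ n <= t ->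
  J l -> J l' -> close l t w w' -> close l' t w w' -> `|l - l'| <= S * t.

(* [c] is large enough for closeness at scale [c * q ^+ n.+1] of two words of
   length n.+1 to force closeness at scale [c * q ^+ n] of their prefixes
   (first summand), and for [3 * t <= c * q ^+ n] whenever [t * q <= q ^+ n]
   (second summand). *)
Let c : R := 2 / (1 - q) + 3 / q.

Let c_ge1 : 1 <= c.
Proof.
have h1 : 0 <= 2 / (1 - q) by rewrite divr_ge0// subr_ge0 ltW.
have h2 : 1 <= 3 / q by rewrite ler_pdivlMr//; have := q1; lra.
by rewrite /c; lra.
Qed.

Let c_ge3q : 3 / q <= c.
Proof.
have h1 : 0 <= 2 / (1 - q) by rewrite divr_ge0// subr_ge0 ltW.
by rewrite /c; lra.
Qed.

Let c_closed : c * q + 2 <= c.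
Proof.
have h2 : 0 <= 3 / q by rewrite divr_ge0// ltW.
by rewrite -lerBrDl -{1}[c]mulr1 -mulrBr -ler_pdivrMr ?subr_gt0// /c lerDl.
Qed.

Let E := 2 * L * (S * c).

(** The heart of the proof. [M w w'] bounds the weight of a pair over all the
    parameters where the pair is close. These parameters lie within
    [S * c * q ^+ n] of each other, so over them the weight of one more letter
    varies by a factor [expR (L * S * c * q ^+ n)] at most; measured at one of
    them the weights of that letter sum to 1. Hence the sum of [M] grows from one
    length to the next by a factor whose product over all lengths converges.
    Taking the supremum of each weight over the whole interval would instead
    lose a factor exponential in the length. *)
Lemma overlap_majorant n : exists M : seq 'I_m.+1 -> seq 'I_m.+1 -> R,
  [/\ forall w w', 0 <= M w w',
      forall l w w', J l -> size w = n.+1 -> size w' = n.+1 ->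
        heads_differ w w' -> close l (c * q ^+ n.+1) w w' ->
        weight (p l) w * weight (p l) w' <= M w w' &
      pair_sum n.+1 (fun w w' => (heads_differ w w')%:R * M w w') <=
        pair_sum 1 (fun _ _ : seq 'I_m.+1 => 1) * expR (E * \sum_(k < n) q ^+ k.+1)].
Proof.
elim: n => [|n [M [M0 Mdom Msum]]].
  exists (fun _ _ => 1); split => //.
  - move=> l w w' Jl w1 w'1 _ _.
    have h (u : seq 'I_m.+1) : weight (p l) u <= 1.
      rewrite -(expr1n R (size u)); apply: weight_le => j; rewrite p0//=.
      rewrite -(p1 Jl) (bigD1 j)//= lerDl; apply: sumr_ge0 => i _.
      exact: p0.
    by rewrite -[leRHS]mulr1 ler_pM ?weight_ge0// => j; apply: p0.
  - rewrite big_ord0 mulr0 expR0 mulr1; apply: ler_pair_sum => w w' _ _.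
    by rewrite mulr1 lern1 leq_b1.
(* A parameter where the prefixes are close, if there is one. *)
pose lam w w' := xget l0 [set l | J l /\ close l (c * q ^+ n.+1) w w'].
have Jlam w w' : J (lam w w') by rewrite /lam; case: xgetP => [? _ []|].
pose e := expR (E * q ^+ n.+1).
pose M' s s' := M (take n.+1 s) (take n.+1 s') * e *
  (p (lam (take n.+1 s) (take n.+1 s')) (last ord0 s) *
   p (lam (take n.+1 s) (take n.+1 s')) (last ord0 s')).
exists M'; split.
- by move=> s s'; rewrite /M' !mulr_ge0 ?expR_ge0 ?M0 ?p0.
- move=> l s s' Jl.
  case/lastP: s => // w i; case/lastP: s' => // w' j.
  rewrite !size_rcons => -[wn] [w'n] hd cl.
  rewrite /M' -!cats1 !take_size_cat// !cats1 !last_rcons.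
  have cw : close l (c * q ^+ n.+1) w w'.
    have := Piq w [:: i] Jl; have := Piq w' [:: j] Jl.
    rewrite !cats1 wn w'n => h1 h2.
    have -> : Pi l w - Pi l w' = (Pi l (rcons w i) - Pi l (rcons w' j))
      - (Pi l (rcons w i) - Pi l w) + (Pi l (rcons w' j) - Pi l w') by ring.
    rewrite (le_trans (ler_normD _ _))// (le_trans (lerD (ler_normB _ _) (lexx _)))//.
    have := ler_wpM2r (exprn_ge0 n.+1 (ltW q0)) c_closed.
    move: cl; rewrite exprS => cl h; lra.
  have hd' : heads_differ w w'.
    move: hd; rewrite /heads_differ; move: wn w'n.
    by case: (w) => // ? ?; case: (w').
  have [Jt ct] : J (lam w w') /\ close (lam w w') (c * q ^+ n.+1) w w'.
    by rewrite /lam; case: xgetP => [? _ //|/(_ l)]; case.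
  have qn : q ^+ n.+1 <= c * q ^+ n.+1 by rewrite ler_peMl// exprn_ge0// ltW.
  have lt := sep (ltn0Sn n) wn w'n hd' qn Jl Jt cw ct.
  have pe k : p l k <= expR (L * (S * (c * q ^+ n.+1))) * p (lam w w') k.
    by rewrite (le_trans (plip k Jl Jt))// ler_wpM2r ?p0// ler_expR ler_wpM2l.
  rewrite -!cats1 !weight_cat /weight !big_seq1 -/(weight (p l) w) -/(weight (p l) w').
  have -> : weight (p l) w * p l i * (weight (p l) w' * p l j) =
    weight (p l) w * weight (p l) w' * (p l i * p l j) by ring.
  rewrite -[leRHS]mulrA; apply: ler_pM.
  + by rewrite mulr_ge0// weight_ge0// => k; apply: p0.
  + by rewrite mulr_ge0// p0.
  + exact: Mdom.
  have -> : e = expR (L * (S * (c * q ^+ n.+1))) * expR (L * (S * (c * q ^+ n.+1))).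
    by rewrite /e -expRD; congr expR; rewrite /E; ring.
  by rewrite mulrACA ler_pM ?p0.
- rewrite -[X in pair_sum X]addn1 pair_sum_cat.
  rewrite [leLHS](_ : _ = e * pair_sum n.+1 (fun w w' => (heads_differ w w')%:R * M w w')).
    rewrite big_ord_recr /= mulrDr expRD mulrA -/e mulrC ler_wpM2r// expR_ge0//.
  rewrite -pair_sumZ; apply: eq_pair_sum => w w' wn w'n.
  rewrite -[RHS]mulr1 -[X in _ = _ * X](pair_sum_weight 1 (p1 (Jlam w w'))) -pair_sumZ.
  apply: eq_pair_sum => -[//|i [|//]] -[//|j [|//]] _ _.
  rewrite /M' !take_size_cat// !cats1 !last_rcons /weight !big_seq1.
  have -> : heads_differ (rcons w i) (rcons w' j) = heads_differ w w'.
    rewrite /heads_differ; move: wn w'n.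
    by case: (w) => // ? ?; case: (w').
  by ring.
Qed.

Let K := pair_sum 1 (fun _ _ : seq 'I_m.+1 => 1 : R).
Let B := K * expR (E / (1 - q)).

Let K0 : 0 <= K. Proof. exact: pair_sum_ge0. Qed.

Let E0 : 0 <= E.
Proof. by rewrite /E !mulr_ge0// (le_trans _ c_ge1). Qed.

Lemma overlap_off_int_dyadic n : int_bounded J
  (fun l => overlap_off (r l) (a l) (p l) x0 n.+1 (c * q ^+ n.+1))
  (B * (2 * (S * (c * q ^+ n.+1)))).
Proof.
have cq0 : 0 <= c * q ^+ n.+1 by rewrite mulr_ge0 ?exprn_ge0 ?(le_trans _ c_ge1)// ltW.
have [M [M0 Mdom Msum]] := overlap_majorant n.
have qsum : \sum_(k < n) q ^+ k.+1 <= (1 - q)^-1.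
  have -> : \sum_(k < n) q ^+ k.+1 = (q - q ^+ n.+1) / (1 - q).
    apply: (@mulIf _ (1 - q)); first by rewrite subr_eq0 gt_eqF.
    rewrite mulfVK ?subr_eq0 ?gt_eqF//.
    elim: n {cq0 M M0 Mdom Msum} => [|n IH]; first by rewrite big_ord0 mul0r expr1 subrr.
    rewrite big_ord_recr /= mulrDl IH [q ^+ n.+2]exprS; ring.
  rewrite -[leRHS]mul1r ler_wpM2r ?invr_ge0 ?subr_ge0 ?ltW//.
  by have := exprn_ge0 n.+1 (ltW q0); have := q1; lra.
have MB : pair_sum n.+1 (fun w w' => (heads_differ w w')%:R * M w w') <= B.
  by rewrite (le_trans Msum)// ler_wpM2l// ler_expR ler_wpM2l.
apply: (@int_boundedW _ _ _ _
   (pair_sum n.+1 (fun w w' =>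
      (heads_differ w w')%:R * M w w' * (2 * (S * (c * q ^+ n.+1)))))
   _ _ _ (fun l _ => lexx _)); last first.
  rewrite (eq_pair_sum (G := fun w w' =>
    (2 * (S * (c * q ^+ n.+1))) * ((heads_differ w w')%:R * M w w'))).
    by rewrite pair_sumZ [leLHS]mulrC ler_wpM2r// mulr_ge0// mulr_ge0.
  by move=> *; rewrite mulrC.
rewrite /overlap_off /pair_sum.
under [X in int_bounded _ X _]eq_fun do rewrite big_seq.
rewrite [X in int_bounded _ _ X]big_seq; apply: int_bounded_sum => // w /size_words wn.
under [X in int_bounded _ X _]eq_fun do rewrite big_seq.
rewrite [X in int_bounded _ _ X]big_seq; apply: int_bounded_sum => // w' /size_words w'n.
apply: (@int_bounded_loc _ _ _ _ _
  [set l | heads_differ w w' /\ close l (c * q ^+ n.+1) w w']) => //.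
- by rewrite mulr_ge0.
- by rewrite mulr_ge0.
- move=> l Jl; rewrite /close_weight -mulrA.
  case: (boolP (heads_differ w w')) => hd; last by rewrite !mul0r.
  rewrite !mul1r; case: (boolP (close l (c * q ^+ n.+1) w w')) => cl; last first.
    by rewrite !mulr0 mulr_ge0// M0.
  rewrite mem_set// !mulr1; exact: Mdom.
- move=> l l' Jl Jl' [hd cl] [_ cl'].
  apply: (sep (ltn0Sn n) wn w'n hd _ Jl Jl' cl cl').
  by rewrite ler_peMl// exprn_ge0// ltW.
Qed.

Let C := Num.max 1 (B * (2 * (S * c))).

(** Truncating the words reduces a scale [t] to the length whose natural scale
    [c * q ^+ k] is comparable with [t]. *)
Lemma overlap_off_int n t : (0 < n)%N -> q ^+ n <= t ->
  int_bounded J (fun l => overlap_off (r l) (a l) (p l) x0 n t) (C * t).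
Proof.
move=> n0 qnt; have t0 : 0 < t by rewrite (lt_le_trans _ qnt)// exprn_gt0.
have [t1|t1] := leP 1 t.
  apply: (int_boundedW (int_bounded_cst mJ muJ ler01)) => [|l Jl].
    by rewrite mulr1 -[leLHS]mulr1 ler_pM// /C le_max lexx.
  by apply: overlap_off_le1 => [j|]; [exact: p0|exact: p1].
have ex : exists k, q ^+ k <= t by exists n.
have [k qk kmin] := ex_minnP ex.
have k0 : (0 < k)%N by case: k qk {kmin} => //; rewrite expr0 leNgt t1.
have kn : (k <= n)%N by apply: kmin.
have tq : t < q ^+ k.-1.
  rewrite ltNge; apply/negP => /kmin; rewrite -ltnS prednK// ltnn//.
have tk : t + 2 * q ^+ k <= c * q ^+ k.
  have h3 : t * q <= q ^+ k by rewrite -[in leRHS](prednK k0) exprSr ler_pM2r// ltW.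
  have h4 : t <= q ^+ k / q by rewrite ler_pdivlMr.
  have h5 : 3 / q * q ^+ k <= c * q ^+ k by rewrite ler_wpM2r// exprn_ge0// ltW.
  have h6 : q ^+ k <= q ^+ k / q by rewrite ler_pdivlMr// ler_piMr ?exprn_ge0 ?ltW.
  apply: le_trans h5; have -> : 3 / q * q ^+ k = 3 * (q ^+ k / q) by ring.
  lra.
have := overlap_off_int_dyadic k.-1; rewrite prednK// => off_k.
apply: (int_boundedW off_k) => [|l Jl].
  have -> : B * (2 * (S * (c * q ^+ k))) = B * (2 * (S * c)) * q ^+ k by ring.
  apply: ler_pM => //; first 2 last.
  - by rewrite /C le_max lexx orbT.
  - by rewrite !mulr_ge0 ?expR_ge0 ?(le_trans _ c_ge1).
  - by rewrite exprn_ge0// ltW.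
rewrite -(subnKC kn).
apply: (le_trans (@overlap_off_truncate _ _ _ _ _ _ _ _ q _ _ _ k0 _)) => [j|||].
- exact: p0.
- exact: p1.
- by move=> w v; apply: Piq.
apply: ler_pair_sum => w w' _ _; rewrite ler_wpM2l// /close_weight ler_wpM2l//.
  by rewrite mulr_ge0// weight_ge0// => j; apply: p0.
rewrite ler_nat; case: (lerP `|_|) => //= h; rewrite lt0b.
exact: le_trans tk.
Qed.

Variables (pbar rlow : 'I_m.+1 -> R).
Hypothesis ppbar : forall l j, J l -> p l j <= pbar j.
Hypothesis rlowr : forall l j, J l -> 0 < rlow j <= r l j.
Hypothesis rq : forall l j, J l -> r l j <= q.
Hypothesis kappa1 : \sum_j pbar j ^+ 2 / rlow j < 1.

(** Common prefixes are stripped one letter at a time: the scale [t] becomes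
    [t / rlow j] and the mass is multiplied by [pbar j ^+ 2], so that the bounds
    add up as a geometric series of ratio [kappa < 1]. *)
Lemma overlap_int : exists D, forall n t, q ^+ n <= t ->
  int_bounded J (fun l => overlap (r l) (a l) (p l) x0 n t) (D * t).
Proof.
pose kappa := \sum_j pbar j ^+ 2 / rlow j.
have k1 : kappa < 1 := kappa1.
pose D := C / (1 - kappa).
have C1 : 1 <= C by rewrite /C le_max lexx.
have kap0 : 0 <= kappa.
  apply: sumr_ge0 => j _; have /andP[rl0 _] := rlowr j Jl0.
  by rewrite divr_ge0 ?sqr_ge0// ltW.
have D1 : 1 <= D by rewrite /D ler_pdivlMr; lra.
have DE : C + kappa * D = D.
  have k1' : 1 - kappa != 0 by rewrite subr_eq0 gt_eqF.
  by rewrite /D; field.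
exists D; elim=> [|n IH] t qt.
  move: qt; rewrite expr0 => t1.
  apply: (int_boundedW (int_bounded_cst mJ muJ ler01)) => [|l Jl].
    by rewrite mulr1 -[leLHS]mulr1 ler_pM.
  rewrite /overlap /pair_sum !big_seq1 /close_weight /weight !big_nil !mul1r.
  by rewrite lern1 leq_b1.
have IHj j : int_bounded J (fun l => pbar j ^+ 2 * overlap (r l) (a l) (p l) x0 n (t / rlow j))
    (pbar j ^+ 2 * (D * (t / rlow j))).
  have /andP[rl0 rlr] := rlowr j Jl0.
  apply: int_boundedZ => //; first exact: sqr_ge0.
  apply: IH; rewrite ler_pdivlMr// (le_trans _ qt)// exprSr.
  by rewrite ler_wpM2l ?(le_trans rlr (rq j Jl0))// exprn_ge0// ltW.
have off := overlap_off_int (ltn0Sn n) qt.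
have := int_boundedD mJ off (@int_bounded_sum _ J _ (index_enum _) predT _ _ mJ (fun j _ => IHj j)).
move=> h; apply: (int_boundedW h) => [|l Jl].
  rewrite -[in leRHS]DE mulrDl lerD2l -mulrA /kappa mulr_suml le_eqVlt; apply/orP; left.
  by apply/eqP; apply: eq_bigr => j _; ring.
apply: overlapS => [j|j|j]; [exact: p0|exact: ppbar|exact: rlowr].
Qed.

End transversal_family.

(** * The natural projection and transversality *)

Section projection.
Variables (R : realType) (m : nat) (r a : 'I_m.+1 -> R) (X : set R) (x0 q : R).
Hypotheses (rq : forall j, 0 <= r j <= q) (q0 : 0 <= q) (q1 : q < 1).
Hypotheses (Xdiam : forall x y, X x -> X y -> `|x - y| <= 1) (Xx0 : X x0).
Hypothesis XX : forall j x, X x -> X (affine_ifs r a j x).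

Lemma apply_word_prefix w v :
  `|apply_word r a x0 (w ++ v) - apply_word r a x0 w| <= q ^+ size w.
Proof.
rewrite /apply_word foldr_cat -/(apply_word r a x0 v).
rewrite -/(apply_word r a x0 w) -/(apply_word r a (apply_word r a x0 v) w).
rewrite apply_wordB normrM -[leRHS]mulr1 ler_pM//.
  rewrite ger0_norm; first exact: weight_le.
  by apply: weight_ge0 => j; case/andP: (rq j).
by apply: Xdiam => //; apply: apply_word_in.
Qed.

Lemma foldr_nat_proj (u : Omega m) n :
  foldr (fun k x => affine_ifs r a (u k) x) x0 (iota 0 n) =
  apply_word r a x0 (mkseq u n).
Proof. by rewrite /apply_word /mkseq foldr_map. Qed.

Lemma nat_proj_cvg (u : Omega m) :
  apply_word r a x0 (mkseq u n) @[n --> \oo] --> nat_proj (affine_ifs r a) x0 u.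
Proof.
rewrite /nat_proj.
rewrite (_ : (fun n => foldr _ _ _) = (fun n => apply_word r a x0 (mkseq u n))); last first.
  by apply/funext => n; rewrite foldr_nat_proj.
suff : cvg (apply_word r a x0 (mkseq u n) @[n --> \oo]) by [].
apply/cauchy_cvgP/cauchy_exP => e e0.
have qn0 : q ^+ n @[n --> \oo] --> 0 by apply: cvg_expr; rewrite ger0_norm.
have [n /= _ hn] := cvgr_lt 0 qn0 _ e0.
exists (apply_word r a x0 (mkseq u n)); exists n => // k /= nk.
rewrite /ball /= distrC.
have -> : mkseq u k = mkseq u n ++ map u (iota n (k - n)).
  by rewrite /mkseq -map_cat -[X in iota X (k - n)]add0n -iotaD subnKC.
rewrite (le_lt_trans (apply_word_prefix _ _))// size_mkseq.
by apply: hn => /=.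
Qed.

Lemma nat_proj_approx (u : Omega m) n :
  `|nat_proj (affine_ifs r a) x0 u - apply_word r a x0 (mkseq u n)| <= q ^+ n.
Proof.
have h : `|apply_word r a x0 (mkseq u k) - apply_word r a x0 (mkseq u n)| @[k --> \oo]
   --> `|nat_proj (affine_ifs r a) x0 u - apply_word r a x0 (mkseq u n)|.
  by apply: cvg_norm; apply: cvgB; [exact: nat_proj_cvg|exact: cvg_cst].
apply: (cvgr_to_le h); exists n => // k /= nk.
have -> : mkseq u k = mkseq u n ++ map u (iota n (k - n)).
  by rewrite /mkseq -map_cat -[X in iota X (k - n)]add0n -iotaD subnKC.
by rewrite (le_trans (apply_word_prefix _ _))// size_mkseq.
Qed.

End projection.

Section projection_lipschitz.
Variables (R : realType) (m : nat) (r r' a a' : 'I_m.+1 -> R) (X : set R) (x0 q d : R).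
Hypotheses (rq : forall j, 0 <= r j <= q) (r'q : forall j, 0 <= r' j <= q).
Hypotheses (q0 : 0 <= q) (q1 : q < 1).
Hypotheses (Xdiam : forall x y, X x -> X y -> `|x - y| <= 1) (Xx0 : X x0).
Hypothesis XX : forall j x, X x -> X (affine_ifs r a j x).
Hypothesis XX' : forall j x, X x -> X (affine_ifs r' a' j x).
Hypothesis fd : forall j x, X x ->
  `|affine_ifs r a j x - affine_ifs r' a' j x| <= d.

(** Each letter adds an error [d] and contracts the previous ones by [q]. *)
Lemma apply_word_dist w :
  `|apply_word r a x0 w - apply_word r' a' x0 w| <= d / (1 - q).
Proof.
have d0 : 0 <= d by rewrite (le_trans _ (fd ord0 Xx0)).
elim: w => [|j w IH].
  by rewrite subrr normr0 divr_ge0// subr_ge0 ltW.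
set x := apply_word r a x0 w in IH *; set y := apply_word r' a' x0 w in IH *.
have -> : apply_word r a x0 (j :: w) - apply_word r' a' x0 (j :: w) =
  (affine_ifs r a j x - affine_ifs r' a' j x) + r' j * (x - y).
  by rewrite /x /y /apply_word /affine_ifs /=; ring.
have Xx : X x by apply: apply_word_in.
rewrite (le_trans (ler_normD _ _))// normrM.
have q10 : 1 - q != 0 by rewrite subr_eq0 gt_eqF.
have -> : d / (1 - q) = d + q * (d / (1 - q)) by field.
have /andP[r'0 r'q'] := r'q j.
by rewrite lerD ?fd// ler_pM// ger0_norm.
Qed.

Lemma nat_proj_dist (u : Omega m) :
  `|nat_proj (affine_ifs r a) x0 u - nat_proj (affine_ifs r' a') x0 u| <= d / (1 - q).
Proof.
have cu := @nat_proj_cvg R m r a X x0 q rq q0 q1 Xdiam Xx0 XX u.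
have cu' := @nat_proj_cvg R m r' a' X x0 q r'q q0 q1 Xdiam Xx0 XX' u.
apply: (cvgr_to_le (cvg_norm (cvgB cu cu'))).
by near=> n; exact: apply_word_dist.
Unshelve. all: by end_near. Qed.

End projection_lipschitz.

Section transversal_separation.
Variable R : realType.

(** [derive1] is 0 where the difference quotient has no limit; a lower bound on
    its absolute value therefore carries differentiability with it. *)
Lemma derive1_neq0_derivable (g : R -> R) (x : R) : derive1 g x != 0 -> derivable g x 1.
Proof.
move=> gx; apply: contrapT => nd; move: gx; rewrite derive1E /derive.
by rewrite dvgP ?eqxx.
Qed.

Lemma dist_le_of_derive1_ge (g : R -> R) (eta x y : R) : 0 < eta ->
  (forall z, Num.min x y <= z <= Num.max x y -> eta <= `|derive1 g z|) ->
  eta * `|x - y| <= `|g x - g y|.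
Proof.
wlog xy : x y / x <= y => [th|].
  case/orP: (le_total x y) => [xy|yx]; first exact: th.
  move=> e0 h; rewrite distrC [leRHS]distrC; apply: th => // z.
  by rewrite minC maxC; exact: h.
rewrite (min_idPl xy) (max_idPr xy) => e0 h.
have dg z : z \in `[x, y] -> derivable g z 1.
  rewrite in_itv /= => zxy; apply: derive1_neq0_derivable.
  by rewrite -normr_gt0 (lt_le_trans e0)// h.
have := @MVT_segment R g (fun z => derive1 g z) x y xy.
case=> [z zxy||z].
- rewrite derive1E; apply: DeriveDef => //; apply: dg.
  exact: subset_itv_oo_cc zxy.
- exact: derivable_within_continuous.
- rewrite in_itv /= => zxy gE; rewrite distrC [leRHS]distrC gE normrM.
  by rewrite ler_wpM2r// h.
Qed.

Variables (m : nat) (U X J : set R) (r a : R -> 'I_m.+1 -> R) (x0 q K : R).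
Let f l := affine_ifs (r l) (a l).
Hypotheses (q0 : 0 <= q) (q1 : q < 1) (K0 : 0 <= K).
Hypotheses (Xdiam : forall x y, X x -> X y -> `|x - y| <= 1) (Xx0 : X x0).
Hypothesis JU : J `<=` U.
Hypothesis Jitv : forall x y z, J x -> J y -> Num.min x y <= z <= Num.max x y -> J z.
Hypothesis rq : forall l j, J l -> 0 <= r l j <= q.
Hypothesis XX : forall l j x, J l -> X x -> X (f l j x).
Hypothesis flip : forall l l' j x, J l -> J l' -> X x ->
  `|f l j x - f l' j x| <= K * `|l - l'|.
Variable eta : R.
Hypothesis eta0 : 0 < eta.
Hypothesis trans : forall l (u v : Omega m), U l -> u 0%N <> v 0%N ->
    `|nat_proj (f l) x0 u - nat_proj (f l) x0 v| < eta ->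
    eta <= `|derive1 (fun k => nat_proj (f k) x0 u - nat_proj (f k) x0 v) l|.
Hypothesis Jsmall : forall l l', J l -> J l' ->
  `|l - l'| <= 1 /\ 2 * (K * `|l - l'| / (1 - q)) < eta / 2.

(** Extend the words to infinite ones. If [t] is not small, the length of [J] is
    bound enough. Otherwise the difference of the two projections, being
    uniformly Lipschitz in the parameter, stays below [eta] on the whole of the
    short interval [J]; transversality then holds between [l] and [l'] and the
    mean value theorem applies. *)
Lemma transversal_separation n (w w' : seq 'I_m.+1) t l l' : (0 < n)%N ->
  size w = n -> size w' = n -> heads_differ w w' -> q ^+ n <= t -> J l -> J l' ->
  `|apply_word (r l) (a l) x0 w - apply_word (r l) (a l) x0 w'| <= t ->
  `|apply_word (r l') (a l') x0 w - apply_word (r l') (a l') x0 w'| <= t ->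
  `|l - l'| <= 6 / eta * t.
Proof.
move=> n0 wn w'n hd qt Jl Jl' cl cl'.
pose u : Omega m := fun k => nth ord0 w k.
pose v : Omega m := fun k => nth ord0 w' k.
have uw : mkseq u n = w by rewrite -wn; exact: mkseq_nth.
have vw : mkseq v n = w' by rewrite -w'n; exact: mkseq_nth.
have uv : u 0%N <> v 0%N by move=> uv; move: hd; rewrite /heads_differ -!nth0 -/(u 0%N) uv eqxx.
pose g k := nat_proj (f k) x0 u - nat_proj (f k) x0 v.
have g3 k : J k -> `|apply_word (r k) (a k) x0 w - apply_word (r k) (a k) x0 w'| <= t ->
    `|g k| <= 3 * t.
  move=> Jk ck.
  have approx (s : Omega m) := nat_proj_approx (fun j => rq j Jk) q0 q1 Xdiam Xx0
    (fun j x => @XX k j x Jk) s n.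
  have h1 := approx u; have h2 := approx v.
  rewrite /g -[nat_proj (f k) x0 u](subrK (apply_word (r k) (a k) x0 w)).
  rewrite -[nat_proj (f k) x0 v](subrK (apply_word (r k) (a k) x0 w')).
  rewrite opprD addrACA (le_trans (ler_normD _ _))//.
  rewrite (le_trans (lerD (ler_normB _ _) (lexx _)))//.
  by rewrite uw in h1; rewrite vw in h2; lra.
have [Js1 Js2] := Jsmall Jl Jl'.
have [te|te] := ltP (eta / 2) (3 * t).
  rewrite (le_trans Js1)// -ler_pdivrMl ?divr_gt0// mulr1 invf_div ler_pdivrMr//; lra.
have gmin z : Num.min l l' <= z <= Num.max l l' -> eta <= `|derive1 g z|.
  move=> zl; have Jz := Jitv Jl Jl' zl; apply: trans => //; first exact: JU.
  rewrite -/(g z) -(subrK (g l) (g z)) (le_lt_trans (ler_normD _ _))//.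
  have gl := g3 l Jl cl.
  have zl' : `|z - l| <= `|l - l'|.
    by case: (leP l l') zl => ll' /andP[h1 h2]; rewrite ler_distl; apply/andP; split;
      [rewrite ler0_norm|rewrite ler0_norm|rewrite ger0_norm|rewrite ger0_norm]; lra.
  have dist s : `|nat_proj (f z) x0 s - nat_proj (f l) x0 s| <= K * `|l - l'| / (1 - q).
    apply: (@nat_proj_dist R m _ _ _ _ X x0 q) => // [j|j|j x|j x|j x] *.
    - exact: rq.
    - exact: rq.
    - exact: XX.
    - exact: XX.
    - by rewrite (le_trans (flip _ Jz Jl _))// ler_wpM2l.
  have gzl : `|g z - g l| <= 2 * (K * `|l - l'| / (1 - q)).
    have -> : g z - g l = (nat_proj (f z) x0 u - nat_proj (f l) x0 u) -
       (nat_proj (f z) x0 v - nat_proj (f l) x0 v) by rewrite /g; ring.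
    rewrite (le_trans (ler_normB _ _))//; have := dist u; have := dist v; lra.
  lra.
have := dist_le_of_derive1_ge eta0 gmin.
have := g3 l Jl cl; have := g3 l' Jl' cl'; have := ler_normB (g l) (g l') => h1 h2 h3 h4.
have h5 : eta * `|l - l'| <= 6 * t by lra.
by rewrite mulrAC ler_pdivlMr// mulrC.
Qed.

End transversal_separation.

(** * Dependence of the similarity dimension on the ratios *)

Section sim_dim_regularity.
Variables (R : realType) (m : nat) (q : R).
Hypothesis q1 : q < 1.
Implicit Types r : 'I_m.+1 -> R.

Lemma powR_expR (x s : R) : 0 < x -> x `^ s = expR (s * ln x).
Proof. by move=> x0; rewrite /powR gt_eqF. Qed.

Lemma sim_dim_ge0 r : (forall j, 0 < r j <= q) -> 0 <= sim_dim r.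
Proof.
move=> rq; have r01 j : 0 < r j < 1.
  by have /andP[r0 rjq] := rq j; rewrite r0 (le_lt_trans rjq).
rewrite leNgt; apply/negP => s0.
have := sim_dimP r01; apply/eqP; rewrite gt_eqF//.
rewrite (bigD1 ord0)//= ltr_wpDr//.
  by apply: sumr_ge0 => j _; exact: powR_ge0.
have /andP[r0 _] := r01 ord0.
by rewrite powR_expR// -expR0 ltr_expR nmulr_rgt0// ln_lt0// r01.
Qed.

Lemma sim_dim_le r : (forall j, 0 < r j <= q) ->
  sim_dim r <= ln m.+1%:R / - ln q.
Proof.
move=> rq; have r01 j : 0 < r j < 1.
  by have /andP[r0 rjq] := rq j; rewrite r0 (le_lt_trans rjq).
have q0 : 0 < q by have /andP[r0 rjq] := rq ord0; exact: lt_le_trans r0 rjq.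
have lnq : 0 < - ln q by rewrite oppr_gt0 ln_lt0// q0 q1.
have h : 1 <= m.+1%:R * expR (sim_dim r * ln q).
  rewrite -[leLHS](sim_dimP r01) mulrC -[X in _ * X%:R]card_ord mulr_natr -sumr_const.
  apply: ler_sum => j _; have /andP[r0 rjq] := rq j.
  rewrite powR_expR// ler_expR ler_wpM2l ?sim_dim_ge0//.
  by rewrite ler_ln ?posrE.
rewrite ler_pdivlMr// mulrN lerNl.
have := h; rewrite -ler_ln ?posrE ?mulr_gt0 ?expR_gt0//.
by rewrite lnM ?posrE ?expR_gt0// expRK ln1; lra.
Qed.

(** With [s] and [s'] the two dimensions, [s' < s], the ratio equations give
    [1 <= expR (s * eps) * q `^ (s - s')]. *)
Lemma sim_dim_dist r r' eps :
  (forall j, 0 < r j <= q) -> (forall j, 0 < r' j <= q) -> 0 <= eps ->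
  (forall j, ln (r j) <= ln (r' j) + eps) ->
  sim_dim r - sim_dim r' <= sim_dim r * eps / - ln q.
Proof.
move=> rq r'q eps0 reps.
have r01 j : 0 < r j < 1.
  by have /andP[r0 rjq] := rq j; rewrite r0 (le_lt_trans rjq).
have r'01 j : 0 < r' j < 1.
  by have /andP[r0 rjq] := r'q j; rewrite r0 (le_lt_trans rjq).
have q0 : 0 < q by have /andP[r0 rjq] := rq ord0; exact: lt_le_trans r0 rjq.
have lnq : 0 < - ln q by rewrite oppr_gt0 ln_lt0// q0 q1.
set s := sim_dim r; set s' := sim_dim r'.
have s0 : 0 <= s := sim_dim_ge0 rq.
have [ss'|s's] := leP s s'.
  by rewrite (@le_trans _ _ 0) ?subr_le0// divr_ge0 ?mulr_ge0// ltW.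
have h : 1 <= expR (s * eps + (s - s') * ln q) * 1.
  rewrite -[X in X <= _](sim_dimP r01) -[X in _ <= _ * X](sim_dimP r'01) mulr_sumr.
  apply: ler_sum => j _; have /andP[r0 rjq] := rq j; have /andP[r'0 r'jq] := r'q j.
  rewrite !powR_expR// -expRD ler_expR -/s -/s'.
  have h1 : s * ln (r j) <= s * (ln (r' j) + eps) by rewrite ler_wpM2l.
  have h2 : (s - s') * ln (r' j) <= (s - s') * ln q.
    by rewrite ler_wpM2l ?ler_ln ?posrE ?subr_ge0// ltW.
  lra.
move: h; rewrite mulr1 -[X in X <= _]expR0 ler_expR ler_pdivlMr//; lra.
Qed.

(** The logarithms of the natural weights are Lipschitz functions of the
    logarithms of the ratios. *)
Lemma natural_weight_lipschitz (rho : R) : 0 < rho -> exists2 M, 0 <= M &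
  forall r r' eps, (forall j, rho <= r j <= q) -> (forall j, rho <= r' j <= q) ->
    (forall j, `|ln (r j) - ln (r' j)| <= eps) ->
    forall j, r j `^ sim_dim r <= expR (M * eps) * r' j `^ sim_dim r'.
Proof.
move=> rho0; have [q0|qrho] := leP rho q; last first.
  exists 0 => // r r' eps rq; have /andP[h1 h2] := rq ord0.
  by have := lt_le_trans qrho (le_trans h1 h2); rewrite ltxx.
have lnq : 0 < - ln q by rewrite oppr_gt0 ln_lt0// (lt_le_trans rho0 q0) q1.
have lnrho : 0 < - ln rho by rewrite oppr_gt0 ln_lt0// rho0 (le_lt_trans q0).
pose smax : R := ln m.+1%:R / - ln q.
have smax0 : 0 <= smax by rewrite divr_ge0 ?ln_ge0 ?ler1n// ltW.
exists (smax * (1 + (- ln rho) / (- ln q))).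
  by rewrite mulr_ge0// addr_ge0// divr_ge0// ltW.
move=> r r' eps rq r'q reps j.
have pos (g : 'I_m.+1 -> R) : (forall j, rho <= g j <= q) -> forall j, 0 < g j <= q.
  by move=> gq i; have /andP[h1 ->] := gq i; rewrite (lt_le_trans rho0 h1).
have rq' := pos _ rq; have r'q' := pos _ r'q.
have eps0 : 0 <= eps by rewrite (le_trans _ (reps ord0)).
have r'reps i : ln (r' i) <= ln (r i) + eps.
  by have := reps i; rewrite ler_norml => /andP[h1 h2]; lra.
have h1 := sim_dim_dist r'q' rq' eps0 r'reps.
have s0 := sim_dim_ge0 rq'; have s'0 := sim_dim_ge0 r'q'.
have sm := sim_dim_le rq'; have s'm := sim_dim_le r'q'; rewrite -/smax in sm s'm.
have /andP[r0 rjq] := rq' j; have /andP[r'0 r'jq] := r'q' j.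
have /andP[r'rho _] := r'q j.
rewrite !powR_expR// -expRD ler_expR.
set s := sim_dim r in h1 s0 sm *; set s' := sim_dim r' in h1 s'0 s'm *.
have lr'0 : 0 <= - ln (r' j).
  by rewrite oppr_ge0 ln_le0// (le_trans r'jq)// ltW.
have lr'rho : - ln (r' j) <= - ln rho by rewrite lerN2 ler_ln ?posrE.
have h2 : s * (ln (r j) - ln (r' j)) <= smax * eps.
  rewrite (@le_trans _ _ (s * eps))//; last by rewrite ler_wpM2r.
  by rewrite ler_wpM2l// (le_trans (ler_norm _)).
have h3 : (s' - s) * (- ln (r' j)) <= smax * eps / (- ln q) * (- ln rho).
  have h4 : s' * eps / - ln q <= smax * eps / - ln q.
    by rewrite ler_wpM2r ?invr_ge0 ?(ltW lnq)// ler_wpM2r.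
  rewrite (@le_trans _ _ (smax * eps / (- ln q) * (- ln (r' j))))//.
    by rewrite ler_wpM2r// (le_trans h1).
  by rewrite ler_wpM2l// divr_ge0 ?(ltW lnq)// mulr_ge0.
have -> : smax * (1 + - ln rho / - ln q) * eps =
  smax * eps + smax * eps / (- ln q) * (- ln rho) by ring.
lra.
Qed.

End sim_dim_regularity.

(** * Auxiliary estimates *)

Section small_parameters.
Variable R : realType.

(** Numbers in ]0, 1[ all exceed their product, which spares a minimum. *)
Lemma exists_uniform_margin (I : finType) (x : I -> R) :
  (forall i, 0 < x i < 1) -> exists rho, 0 < rho < 1 /\ forall i, rho <= x i.
Proof.
move=> x01; exists ((\prod_i x i) / 2).
have prod_le1 (P : pred I) : 0 <= \prod_(i | P i) x i <= 1.
  apply/andP; split; first by apply: prodr_ge0 => i _; case/andP: (x01 i) => /ltW.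
  by apply: prodr_ile1 => i _; have /andP[/ltW -> /ltW ->] := x01 i.
have p0 : 0 < \prod_i x i by apply: prodr_gt0 => i _; case/andP: (x01 i).
have /andP[_ p1] := prod_le1 predT.
split=> [|i]; first by apply/andP; split; lra.
have : \prod_i x i <= x i.
  have /andP[xi0 xi1] := x01 i; rewrite (bigD1 i)//= -[leRHS]mulr1.
  by rewrite ler_wpM2l ?(ltW xi0)//; case/andP: (prod_le1 (fun j => j != i)).
lra.
Qed.

Lemma exists_small (s : seq (R * R)) : all (fun kd => (0 <= kd.1) && (0 < kd.2)) s ->
  exists2 e, 0 < e & all (fun kd => kd.1 * e < kd.2) s.
Proof.
elim: s => [|[k d] s IH] /=; first by exists 1.
move=> /andP[/andP[k0 d0] s0]; have [e e0 es] := IH s0.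
exists (Num.min e (d / (k + 1))).
  by rewrite lt_min e0 divr_gt0// ltr_wpDl.
apply/andP; split.
  have k1 : 0 < k + 1 by lra.
  apply: (@le_lt_trans _ _ (k * (d / (k + 1)))).
    by rewrite ler_wpM2l// ge_min lexx orbT.
  by rewrite mulrA ltr_pdivrMr// mulrDr mulr1 mulrC ltrDl.
apply/allP => kd kds; have /allP/(_ _ kds) := es; apply: le_lt_trans.
by rewrite ler_wpM2l ?ge_min ?lexx//; have /allP/(_ _ kds)/andP[] := s0.
Qed.

End small_parameters.

Section ln_lipschitz.
Variable R : realType.

Lemma ln_dist (rho x y : R) : 0 < rho -> rho <= x -> rho <= y ->
  `|ln x - ln y| <= `|x - y| / rho.
Proof.
move=> rho0.
have aux u v : rho <= u -> rho <= v -> ln u - ln v <= `|u - v| / rho.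
  move=> ru rv; have u0 := lt_le_trans rho0 ru; have v0 := lt_le_trans rho0 rv.
  rewrite -ln_div ?posrE//.
  have -> : u / v = 1 + (u - v) / v by rewrite mulrBl divff ?gt_eqF// addrC subrK.
  apply: (le_trans (le_ln1Dx _)).
    have : 0 < u / v by rewrite divr_gt0.
    by rewrite mulrBl divff ?gt_eqF//; lra.
  apply: (le_trans (ler_norm _)); rewrite normrM ler_wpM2l// gtr0_norm ?invr_gt0//.
  by rewrite lef_pV2 ?posrE.
move=> rx ry; rewrite ler_norml; apply/andP; split; last exact: aux.
by rewrite lerNl opprB distrC; exact: aux.
Qed.

End ln_lipschitz.

(** * Measures whose smoothings are bounded in L2 *)

Section limit_inferior.
Variable R : realType.
Implicit Types u v : (\bar R)^nat.
Local Open Scope ereal_scope.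

Lemma le_limn_einf u v : (forall n, u n <= v n) -> limn_einf u <= limn_einf v.
Proof.
move=> uv; rewrite !limn_einf_lim; apply: lee_lim; [exact: is_cvg_einfs..|].
near=> n; apply: le_ereal_inf_tmp => _ [k /= nk <-].
by apply: (@le_trans _ _ (u k)) => //; apply: ereal_inf_lbound; exists k.
Unshelve. all: by end_near. Qed.

Lemma limn_einf_le_cst u c : (forall n, u n <= c) -> limn_einf u <= c.
Proof.
move=> uc; rewrite limn_einf_lim; apply: lime_le; first exact: is_cvg_einfs.
near=> n; apply: (@le_trans _ _ (u n)) => //.
by apply: ereal_inf_lbound; exists n => /=.
Unshelve. all: by end_near. Qed.

Lemma limn_einf_frequently u (c : R) : limn_einf u < c%:E ->
  forall n, exists2 k, (n <= k)%N & u k < c%:E.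
Proof.
rewrite limn_einf_lim => uc n.
have : einfs u n < c%:E.
  apply: le_lt_trans uc; apply: lime_ge; first exact: is_cvg_einfs.
  by exists n => // k /= nk; apply: nondecreasing_einfs.
by move=> /ereal_inf_lt[_ [k /= nk <-] ukc]; exists k.
Qed.

Lemma limn_einf_ge0 u : (forall n, 0 <= u n) -> 0 <= limn_einf u.
Proof.
move=> u0; apply: (@le_trans _ _ (limn_einf (fun=> 0 : \bar R))).
  have c0 : (fun _ : nat => 0 : \bar R) @ \oo --> (0 : \bar R) by exact: cvg_cst.
  by have [-> _] := cvg_limn_einf_sup c0.
exact: le_limn_einf.
Qed.

End limit_inferior.

Section L2_criterion.
Variables (R : realType) (nu : {finite_measure set (measurableTypeR R) -> \bar R}).
(* [F k] stands for a smoothing of [nu] at scale [h k]. *)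
Variables (F : nat -> R -> R) (h : nat -> R) (C : R).
Local Notation mu := (@lebesgue_measure R).
Hypotheses (h0 : forall k, 0 < h k) (hcvg : h k @[k --> \oo] --> 0).
Hypotheses (mF : forall k, measurable_fun setT (F k)) (F0 : forall k x, 0 <= F k x).
Hypothesis FC : forall k, (\int[mu]_x (F k x ^+ 2)%:E <= C%:E)%E.
Hypothesis Favg : forall k x,
  (nu ([set` `[x - h k / 2, x + h k / 2]] : set R)%R <= (h k * F k x)%:E)%E.
Hypothesis Fsub : forall k (A G : set R), measurable A -> measurable G ->
  (forall x y, A x -> `|x - y| <= 2 * h k -> G y) ->
  (nu A <= \int[mu]_(x in G) (F k x)%:E)%E.

Let C0 : 0 <= C.
Proof.
rewrite -lee_fin (le_trans _ (FC 0))//; apply: integral_ge0 => x _.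
by rewrite lee_fin sqr_ge0.
Qed.

Let mF2 k : measurable_fun setT (fun x => (F k x ^+ 2)%:E).
Proof. by apply/measurable_EFinP; apply: measurable_funX. Qed.

(** [a <= eps * a ^+ 2 + eps^-1] plays the role of the Cauchy-Schwarz
    inequality. *)
Lemma smoothing_integral_le k (G : set R) (eps : R) : measurable G -> 0 < eps ->
  (\int[mu]_(x in G) (F k x)%:E <= (eps * C)%:E + eps^-1%:E * mu G)%E.
Proof.
move=> mG e0.
apply: (@le_trans _ _ (\int[mu]_(x in G) (eps%:E * (F k x ^+ 2)%:E + eps^-1%:E))%E).
  apply: ge0_le_integral => //.
  - by move=> x _; rewrite lee_fin.
  - by apply/measurable_EFinP; apply: measurable_funTS; exact: mF.
  - apply: emeasurable_funD => //; apply: measurable_funeM.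
    by apply: measurable_funTS; exact: mF2.
  - move=> x _; rewrite -EFinM -EFinD lee_fin.
    have ei : eps * eps^-1 = 1 by rewrite divff// gt_eqF.
    have i0 : 0 < eps^-1 by rewrite invr_gt0.
    have e2 : 0 <= eps * (F k x - eps^-1) ^+ 2 by rewrite mulr_ge0 ?sqr_ge0// ltW.
    have E : eps * (F k x - eps^-1) ^+ 2 =
        eps * F k x ^+ 2 - 2 * F k x * (eps * eps^-1) + (eps * eps^-1) * eps^-1 by ring.
    rewrite E ei in e2; have := F0 k x; lra.
have mF2G : measurable_fun G (fun x => (F k x ^+ 2)%:E).
  by apply: measurable_funTS; exact: mF2.
have F2ge0 x : G x -> (0 <= (F k x ^+ 2)%:E)%E by rewrite lee_fin sqr_ge0.
have mepsF2 : measurable_fun G (fun x => eps%:E * (F k x ^+ 2)%:E)%E by exact: measurable_funeM.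
have epsF2 x : G x -> (0 <= eps%:E * (F k x ^+ 2)%:E)%E.
  by move=> Gx; rewrite mule_ge0 ?F2ge0// lee_fin ltW.
have epsV x : G x -> (0 <= eps^-1%:E)%E by rewrite lee_fin invr_ge0 ltW.
rewrite ge0_integralD//.
rewrite integral_cst// leeD2r// ge0_integralZl ?lee_fin ?(ltW e0)//.
rewrite EFinM lee_wpmul2l ?lee_fin ?(ltW e0)//.
apply: le_trans (FC k); apply: ge0_subset_integral => //; first exact: mF2.
by move=> x _; rewrite lee_fin sqr_ge0.
Qed.

(** An open set [G] is the increasing union of the closed sets [D n] of points at
    distance at least [n.+1%:R^-1] from its complement; for [h k] small compared
    with [n.+1%:R^-1], the mass of [D n] is controlled by the integral of [F k]
    over [G]. *)
Lemma measure_open_le (G : set R) (eps : R) : open G -> 0 < eps ->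
  (nu G <= (eps * C)%:E + eps^-1%:E * mu G)%E.
Proof.
move=> oG e0.
pose D n : set R := ~` \bigcup_(y in ~` G) ball y (n.+1%:R^-1 : R).
have mD n : measurable (D n : set R).
  apply: measurableC; apply: open_measurable.
  by apply: bigcup_open => y _; exact: ball_open.
have DG : \bigcup_n D n = G.
  apply/seteqP; split=> [x [n _ Dx]|x Gx].
    apply: contrapT => nGx; apply: Dx; exists x => //.
    by apply: ballxx; rewrite invr_gt0.
  have /nbhs_ballP[e /= e0' eG] := open_nbhs_nbhs (conj oG Gx).
  have [n nle] : exists n, n.+1%:R^-1 < e.
    by have [n _ nn] := near_infty_natSinv_lt (PosNum e0'); exists n; apply: nn => /=.
  exists n => // -[y nGy yx]; apply: nGy; apply: eG.
  by apply: ball_sym; apply: le_ball yx; exact: ltW.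
have Dmono : {homo D : n k / (n <= k)%N >-> (n <= k)%O}.
  move=> n k nk; apply/subsetPset; apply: subsetC => x [y nGy yx]; exists y => //.
  by apply: le_ball yx; rewrite lef_pV2 ?posrE// ler_nat ltnS.
have mUD : measurable (\bigcup_n D n : set R) by apply: bigcup_measurable => n _; exact: mD.
have := @nondecreasing_cvg_mu _ _ _ nu D mD mUD Dmono.
rewrite DG => cvgD; rewrite -(cvg_lim _ cvgD)//.
apply: lime_le; first by apply/cvg_ex; exists (nu G).
near=> n => /=.
have [k hk] : exists k, 2 * h k < n.+1%:R^-1.
  have h20 : 0 < (n.+1%:R^-1 : R) / 2 by rewrite divr_gt0.
  have [k _ /(_ k (leqnn k))/= hk] := cvgr_lt 0 hcvg _ h20.
  by exists k; rewrite mulrC -ltr_pdivlMr.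
apply: le_trans (smoothing_integral_le k (open_measurable oG) e0).
apply: Fsub => //; first exact: open_measurable.
move=> x y Dx xy; apply: contrapT => nGy; apply: Dx; exists y => //.
by apply: ball_sym; rewrite /ball/=; exact: le_lt_trans hk.
Unshelve. all: by end_near. Qed.

(** Enclose a null set in an open set of measure at most [eps ^+ 2]. *)
Lemma smoothing_dominates : nu `<< mu.
Proof.
apply/null_content_dominatesP => A mA A0.
apply/eqP; rewrite eq_le measure_ge0 andbT; apply/lee_addgt0Pr => e e0.
rewrite add0e.
pose eps := e / (C + 1); have C1 : 0 < C + 1 by have := C0; lra.
have eps0 : 0 < eps by rewrite divr_gt0.
have [||G [oG AG muG]] := @lebesgue_regularity_outer R A (eps ^+ 2) mA.
- by rewrite A0.
- by rewrite exprn_gt0.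
have mG := open_measurable oG.
have muG' : (mu G <= (eps ^+ 2)%:E)%E.
  rewrite -(setDUK AG); apply: (le_trans (measureU2 _ mA (measurableD mG mA))).
  by rewrite [X in (X + _)%E](A0 : _ = _) add0e ltW.
apply: (@le_trans _ _ (nu G)); first by apply: le_measure; rewrite ?inE.
apply: (le_trans (measure_open_le oG eps0)).
apply: (@le_trans _ _ ((eps * C)%:E + eps^-1%:E * (eps ^+ 2)%:E)%E).
  by rewrite leeD2l// lee_wpmul2l// lee_fin invr_ge0 ltW.
rewrite -EFinM -EFinD lee_fin expr2 mulKf ?gt_eqF//.
have -> : eps * C + eps = eps * (C + 1) by ring.
by rewrite /eps mulfVK// gt_eqF.
Qed.

(* The density. By the Lebesgue differentiation theorem it is almost everywhere
   the limit of the averages of [nu] at scale [h k], hence bounded by the lower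
   limit of the [F k], and Fatou's lemma bounds its L2 norm. *)
Let g x := fine (Radon_Nikodym_SigmaFinite.f nu mu x).

Let gE x : (g x)%:E = Radon_Nikodym_SigmaFinite.f nu mu x.
Proof. by rewrite fineK// Radon_Nikodym_SigmaFinite.f_fin_num//; exact: smoothing_dominates. Qed.

Let g0 x : 0 <= g x.
Proof. by rewrite -lee_fin gE Radon_Nikodym_SigmaFinite.f_ge0//; exact: smoothing_dominates. Qed.

Let g_integrable : mu.-integrable setT (EFin \o g).
Proof.
rewrite (_ : EFin \o g = Radon_Nikodym_SigmaFinite.f nu mu).
  exact: Radon_Nikodym_SigmaFinite.f_integrable smoothing_dominates.
by apply/funext => x; rewrite /= gE.
Qed.

Let g_integral (A : set R) : measurable A -> nu A = (\int[mu]_(x in A) (g x)%:E)%E.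
Proof.
move=> mA; rewrite (Radon_Nikodym_SigmaFinite.f_integral smoothing_dominates mA).
by apply: eq_integral => x _; rewrite gE.
Qed.

Let mg : measurable_fun setT g.
Proof. by case/integrableP : g_integrable => /measurable_EFinP. Qed.

Let g_le_liminf : {ae mu, forall x, ((g x ^+ 2)%:E <= limn_einf (fun k => (F k x ^+ 2)%:E))%E}.
Proof.
pose E x k : set R := [set` `[x - h k / 2, x + h k / 2]].
have muE x k : mu (E x k) = (h k)%:E.
  rewrite /E lebesgue_measure_itv/= lte_fin; have := h0 k => hk.
  by rewrite ifT ?EFinN -?EFinB; [congr EFin; field|lra].
have nE x : nicely_shrinking x (E x).
  split; first by move=> n; exact: measurable_itv.
  exists (2, fun k => PosNum (h0 k)); split => //=.
  - move=> k y; rewrite /E/= in_itv/= => /andP[h1 h2]; rewrite /ball/= ltr_norml.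
    by have hk := h0 k; apply/andP; split; lra.
  - move=> k; rewrite lebesgue_measure_ball ?(ltW (h0 k))// muE -EFinM lee_fin.
    by rewrite [leRHS]mulr_natl.
have lg : locally_integrable setT g.
  by apply: open_integrable_locally => //; exact: openT.
have := lebesgue_differentiation lg; apply: negligibleS => x /=; apply: contra_not => lx.
have cx := nice_lebesgue_differentiation nE lg lx.
have c2 : ((fine ((mu (E x k))^-1 * \int[mu]_(y in E x k) (g y)%:E)) ^+ 2)%:E
    @[k --> \oo] --> (g x ^+ 2)%:E.
  apply/fine_cvgP; split; first by near=> k.
  rewrite /comp /= expr2; under eq_cvg do rewrite expr2.
  by move/fine_cvgP : cx => [_ cx]; apply: cvgM.
have [<- _] := cvg_limn_einf_sup c2.
apply: le_limn_einf => k; rewrite -g_integral; last exact: measurable_itv.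
rewrite muE inver gt_eqF// lee_fin.
have nuf : nu (E x k) \is a fin_num by apply: fin_num_measure; exact: measurable_itv.
have := Favg k x; rewrite -/(E x k) -(fineK nuf) -EFinM lee_fin /= => hF.
have nu0 : 0 <= fine (nu (E x k)) by apply: fine_ge0; exact: measure_ge0.
rewrite lerXn2r ?nnegrE//; first by rewrite mulr_ge0// invr_ge0 ltW.
by rewrite ler_pdivrMl.
Unshelve. all: by end_near. Qed.

Lemma smoothing_L2_density : has_L2_density nu.
Proof.
exists g; split => //.
rewrite inE/=; apply/andP; split; first by rewrite inE/=.
rewrite inE/= /finite_norm unlock.
apply: poweR_lty.
rewrite (eq_integral (fun x => (g x ^+ 2)%:E)); last first.
  by move=> x _; rewrite /= ger0_norm// powR_mulrn.
apply: (@le_lt_trans _ _ C%:E); last exact: ltry.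
apply: (@le_trans _ _ (\int[mu]_x limn_einf (fun k => (F k x ^+ 2)%:E))%E).
  apply: ae_ge0_le_integral => //.
  - by move=> x _; rewrite lee_fin sqr_ge0.
  - by apply/measurable_EFinP; apply: measurable_funX.
  - by move=> x _; apply: limn_einf_ge0 => n; rewrite lee_fin sqr_ge0.
  - rewrite /limn_einf; apply: measurableT_comp => //.
    apply: measurable_fun_limn_esup => k; apply: measurableT_comp => //; exact: mF2.
  - by have := g_le_liminf; apply: negligibleS => x /=; apply: contra_not => gx _.
apply: (@le_trans _ _ (limn_einf (fun k => \int[mu]_x (F k x ^+ 2)%:E))%E).
  by apply: fatou => // k x _; rewrite lee_fin sqr_ge0.
exact: limn_einf_le_cst.
Qed.

End L2_criterion.

(** * From overlap bounds to an L2 density, for a fixed parameter *)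

Section coded_measure.
Variables (R : realType) (m : nat) (r a p : 'I_m.+1 -> R) (X : set R) (x0 q : R).
Variable P : probability (Omega m) R.
Local Notation mu := (@lebesgue_measure R).
Local Notation Pi w := (apply_word r a x0 w).
Local Notation proj := (nat_proj (affine_ifs r a) x0).
Hypotheses (rq : forall j, 0 <= r j <= q) (q0 : 0 < q) (q1 : q < 1).
Hypotheses (Xdiam : forall x y, X x -> X y -> `|x - y| <= 1) (Xx0 : X x0).
Hypothesis XX : forall j x, X x -> X (affine_ifs r a j x).
Hypotheses (p0 : forall j, 0 <= p j) (PE : is_bernoulli p P).

Let mcyl (w : seq 'I_m.+1) : measurable (cylinder w : set (Omega m)).
Proof. by apply: sub_sigma_algebra; exists w. Qed.

Lemma measurable_nat_proj : measurable_fun setT (proj : Omega m -> R).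
Proof.
apply: (@measurable_fun_cvg _ _ _ _ (fun n (u : Omega m) => Pi (mkseq u n))); last first.
  by move=> u _; apply: (nat_proj_cvg rq (ltW q0) q1 Xdiam Xx0 XX).
move=> n _ Y mY; rewrite setTI.
rewrite (_ : _ @^-1` _ = \big[setU/set0]_(w <- words m n | `[< Y (Pi w) >]) cylinder w); last first.
  rewrite -bigcup_seq_cond; apply/seteqP; split=> [u /= Yu|u [w /= /andP[wn /asboolP Yw] uw]].
    exists (mkseq u n); last by rewrite /cylinder/= size_mkseq.
    apply/andP; split; last exact/asboolP.
    by have := mem_words (mkseq u n); rewrite size_mkseq.
  by move: uw; rewrite /cylinder/= (size_words wn) => ->.
by apply: bigsetU_measurable => w _; exact: mcyl.
Qed.

Lemma bernoulli_le (A : set (Omega m)) n (D : pred (seq 'I_m.+1)) : measurable A ->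
  (forall u, A u -> D (mkseq u n)) ->
  (P A <= (\sum_(w <- words m n | D w) weight p w)%:E)%E.
Proof.
move=> mA AD.
have sub : A `<=` \big[setU/set0]_(w <- words m n | D w) (cylinder w : set (Omega m)).
  move=> u Au; rewrite -bigcup_seq_cond; exists (mkseq u n); last by rewrite /cylinder/= size_mkseq.
  apply/andP; split; last exact: AD.
  by have := mem_words (mkseq u n); rewrite size_mkseq.
apply: (@le_trans _ _ (P (\big[setU/set0]_(w <- words m n | D w) (cylinder w : set (Omega m))))).
  by apply: le_measure; rewrite ?inE//; apply: bigsetU_measurable => w _; exact: mcyl.
elim: (words m n) => [|w s IH]; first by rewrite !big_nil measure0.
rewrite !big_cons; case: ifP => // Dw; rewrite EFinD.
apply: (le_trans (measureU2 _ _ _)); [exact: mcyl| |].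
  by apply: bigsetU_measurable => v _; exact: mcyl.
by rewrite leeD// [X in (X <= _)%E](PE w).
Qed.

(** Each atom of the level-[n] discretization is replaced by a window of
    half-width [2 * q ^+ n]: twice the discretization error, so that windows
    cover the points they stand for. The total mass is 2, not 1. *)
Definition smoothing n x : R := (2 * q ^+ n)^-1 *
  \sum_(w <- words m n) weight p w * (`|x - Pi w| <= 2 * q ^+ n)%R%:R.

Let qn0 n : 0 < q ^+ n. Proof. exact: exprn_gt0. Qed.

Let indE n (c : R) : (fun x : R => (`|x - c| <= 2 * q ^+ n)%R%:R : R) =
  \1_([set` `[c - 2 * q ^+ n, c + 2 * q ^+ n]]).
Proof.
apply/funext => x; rewrite indicE; congr (_%:R); congr nat_of_bool.
by rewrite mem_setE /= in_itv /= ler_distl.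
Qed.

Lemma smoothing_ge0 n x : 0 <= smoothing n x.
Proof.
rewrite mulr_ge0 ?invr_ge0 ?mulr_ge0 ?(ltW (qn0 n))//.
by apply: sumr_ge0 => w _; rewrite mulr_ge0// weight_ge0.
Qed.

Lemma measurable_smoothing n : measurable_fun setT (smoothing n).
Proof.
apply: measurable_funM => //; apply: measurable_sum => w.
apply: measurable_funM => //; rewrite indE.
by apply: measurable_indic; exact: measurable_itv.
Qed.

(** Expanding the square, a pair of windows contributes only if its two words
    are [4 * q ^+ n]-close. *)
Lemma smoothing_sq_integral n C : overlap r a p x0 n (4 * q ^+ n) <= C * q ^+ n ->
  (\int[mu]_x (smoothing n x ^+ 2)%:E <= (2 * C)%:E)%E.
Proof.
move=> ovC; apply: int_bounded_integral => //.
- by apply: measurable_funX; exact: measurable_smoothing.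
- by move=> x _; exact: sqr_ge0.
pose S : R -> R := fun x => pair_sum n (fun w w' => weight p w * (`|x - Pi w| <= 2 * q ^+ n)%R%:R *
  (weight p w' * (`|x - Pi w'| <= 2 * q ^+ n)%R%:R)).
have SE x : smoothing n x ^+ 2 = (2 * q ^+ n) ^- 2 * S x.
  rewrite /smoothing exprMn exprVn; congr (_ * _).
  by rewrite expr2 mulr_suml; apply: eq_bigr => w _; rewrite mulr_sumr.
have hS : int_bounded setT S (pair_sum n (fun w w' =>
    close_weight r a p x0 (4 * q ^+ n) w w' * (2 * (4 * q ^+ n)))).
  rewrite /S /pair_sum; apply: int_bounded_sum => // w _.
  apply: int_bounded_sum => // w' _.
  apply: (@int_bounded_loc _ _ _ _ _
    [set x | `|x - Pi w| <= 2 * q ^+ n /\ `|x - Pi w'| <= 2 * q ^+ n]) => //.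
  - exact: close_weight_ge0.
  - by rewrite mulr_ge0// ltW.
  - move=> x _.
    case: (lerP `|x - Pi w|) => h1; last first.
      by rewrite mulr0 mul0r mulr_ge0//; exact: close_weight_ge0.
    case: (lerP `|x - Pi w'|) => h2; last first.
      by rewrite !mulr0 mulr_ge0//; exact: close_weight_ge0.
    rewrite mem_set// !mulr1 /close_weight.
    have -> : `|Pi w - Pi w'| <= 4 * q ^+ n; last by rewrite mulr1.
    have -> : Pi w - Pi w' = (x - Pi w') - (x - Pi w) by ring.
    by rewrite (le_trans (ler_normB _ _))//; lra.
  - move=> x y _ _ [h1 _] [h2 _].
    have -> : x - y = (x - Pi w) - (y - Pi w) by ring.
    by rewrite (le_trans (ler_normB _ _))//; lra.
have c0 : 0 <= (2 * q ^+ n) ^- 2 by rewrite invr_ge0 sqr_ge0.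
apply: (int_boundedW (int_boundedZ measurableT c0 hS)) => [|x _]; last by rewrite SE.
rewrite (eq_pair_sum (G := fun w w' =>
  (2 * (4 * q ^+ n)) * close_weight r a p x0 (4 * q ^+ n) w w')); last first.
  by move=> w w' _ _; rewrite mulrC.
rewrite pair_sumZ -/(overlap r a p x0 n (4 * q ^+ n)).
have qne : q ^+ n != 0 by rewrite gt_eqF.
have -> : (2 * q ^+ n) ^- 2 * (2 * (4 * q ^+ n) * overlap r a p x0 n (4 * q ^+ n)) =
  2 * (overlap r a p x0 n (4 * q ^+ n) / q ^+ n) by field.
by rewrite ler_pM2l// ler_pdivrMr.
Qed.

Let approx u n := nat_proj_approx rq (ltW q0) q1 Xdiam Xx0 XX u n.

Lemma nat_proj_interval_le n x :
  (P (proj @^-1` [set` `[(x - q ^+ n)%R, (x + q ^+ n)%R]]) <=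
    (2 * q ^+ n * smoothing n x)%:E)%E.
Proof.
rewrite /smoothing mulrA divff ?mulf_neq0 ?gt_eqF// mul1r.
rewrite [X in X%:E](_ : _ =
  \sum_(w <- words m n | `|x - Pi w| <= 2 * q ^+ n) weight p w); last first.
  by rewrite [RHS]big_mkcond; apply: eq_bigr => w _; case: ifP; rewrite ?mulr1 ?mulr0.
apply: bernoulli_le.
  by rewrite -[X in measurable X]setTI; apply: measurable_nat_proj => //; exact: measurable_itv.
move=> u /=; rewrite in_itv/= -ler_distl => ux.
have -> : x - Pi (mkseq u n) = (proj u - Pi (mkseq u n)) - (proj u - x) by ring.
by rewrite (le_trans (ler_normB _ _))//; have := approx u n; lra.
Qed.

Lemma nat_proj_preimage_le n (A G : set R) : measurable A -> measurable G ->
  (forall x y, A x -> `|x - y| <= 2 * (2 * q ^+ n) -> G y) ->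
  (P (proj @^-1` A) <= \int[mu]_(x in G) (smoothing n x)%:E)%E.
Proof.
move=> mA mG AG.
pose B w : set R := [set` `[Pi w - 2 * q ^+ n, Pi w + 2 * q ^+ n]].
pose D w := `[< B w `<=` G >].
apply: (@le_trans _ _ (\sum_(w <- words m n | D w) weight p w)%:E).
  apply: bernoulli_le.
    by rewrite -[X in measurable X]setTI; exact: measurable_nat_proj.
  move=> u Au; apply/asboolP => y; rewrite /B/= in_itv/= -ler_distl => yB.
  apply: (AG _ _ Au).
  have -> : proj u - y = (proj u - Pi (mkseq u n)) - (y - Pi (mkseq u n)) by ring.
  by rewrite (le_trans (ler_normB _ _))//; have := approx u n; have := qn0 n; lra.
under eq_integral => x _.
  rewrite /smoothing mulr_sumr -sumEFin; over.
rewrite /= ge0_integral_sum//; last 2 first.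
- move=> w; apply/measurable_EFinP; apply: measurable_funM => //.
  apply: measurable_funM => //; rewrite indE.
  by apply: measurable_indic; exact: measurable_itv.
- move=> w x _; rewrite lee_fin mulr_ge0 ?invr_ge0 ?mulr_ge0 ?(ltW (qn0 n))//.
  exact: weight_ge0.
rewrite -sumEFin big_mkcond; apply: lee_sum => w _; case: ifPn => [/asboolP BG|_]; last first.
  apply: integral_ge0 => x _; rewrite lee_fin mulr_ge0 ?invr_ge0 ?mulr_ge0 ?(ltW (qn0 n))//.
  exact: weight_ge0.
apply: (@le_trans _ _ (\int[mu]_(x in G) (((2 * q ^+ n)^-1 * weight p w)%:E * (\1_(B w) x)%:E))%E).
  rewrite ge0_integralZl//; last 2 first.
  - by apply/measurable_EFinP; apply: measurable_indic; exact: measurable_itv.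
  - by rewrite lee_fin mulr_ge0 ?weight_ge0// invr_ge0 mulr_ge0// ltW.
  rewrite integral_indic//; last exact: measurable_itv.
  have muB : mu (B w) = (4 * q ^+ n)%:E.
    rewrite /B lebesgue_measure_itv/= lte_fin; have qn := qn0 n.
    by rewrite ifT ?EFinN -?EFinB; [congr EFin; ring|lra].
  rewrite setIidl// [X in (_ <= _ * X)%E](muB : _ = _) -EFinM lee_fin.
  have qne : q ^+ n != 0 by rewrite gt_eqF.
  have -> : (2 * q ^+ n)^-1 * weight p w * (4 * q ^+ n) = 2 * weight p w by field.
  by have w0 : 0 <= weight p w := weight_ge0 w p0; lra.
rewrite le_eqVlt; apply/orP; left; apply/eqP; apply: eq_integral => x _.
rewrite -EFinM -mulrA; congr EFin; congr (_ * (_ * _)).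
by rewrite -[RHS]/((fun x : R => _) x) indE.
Qed.

(** The smoothings along the good lengths satisfy the hypotheses of
    [smoothing_dominates] and [smoothing_L2_density]. *)
Lemma overlap_L2_density (C : R) :
  (forall k, exists2 n, (k <= n)%N & overlap r a p x0 n (4 * q ^+ n) <= C * q ^+ n) ->
  pushforward P proj `<< mu /\ has_L2_density (pushforward P proj).
Proof.
move=> freq.
have /choice[phi phiP] : forall k, exists n,
    (k <= n)%N /\ overlap r a p x0 n (4 * q ^+ n) <= C * q ^+ n.
  by move=> k; have [n kn nC] := freq k; exists n.
have mproj : (proj : Omega m -> measurableTypeR R) \in mfun.
  by rewrite inE; exact: measurable_nat_proj.
pose Y : {mfun Omega m >-> measurableTypeR R} := mfun_Sub mproj.
pose nu := distribution P Y.
have nuE : pushforward P proj = nu :> (set R -> \bar R) by [].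
rewrite nuE.
pose h k : R := 2 * q ^+ (phi k).
have h0 k : 0 < h k by rewrite mulr_gt0.
have hcvg : h k @[k --> \oo] --> 0.
  have qk : 2 * q ^+ k @[k --> \oo] --> (0 : R).
    rewrite -[X in _ --> X](mulr0 2); apply: cvgMr; apply: cvg_expr.
    by rewrite gtr0_norm.
  apply: (squeeze_cvgr _ (cvg_cst 0) qk).
  near=> k; rewrite ltW ?h0//= ler_pM2l// ler_wiXn2l ?ltW//.
  by case: (phiP k).
have FC k := smoothing_sq_integral (phiP k).2.
have Favg k x : (nu ([set` `[(x - h k / 2)%R, (x + h k / 2)%R]] : set R) <=
    (h k * smoothing (phi k) x)%:E)%E.
  have -> : h k / 2 = q ^+ phi k by rewrite /h mulrAC divff// mul1r.
  exact: nat_proj_interval_le.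
have Fsub k (A G : set R) : measurable A -> measurable G ->
  (forall x y, A x -> `|x - y| <= 2 * h k -> G y) ->
  (nu A <= \int[mu]_(x in G) (smoothing (phi k) x)%:E)%E.
  exact: nat_proj_preimage_le.
have mF k := measurable_smoothing (phi k).
have F0 k x := smoothing_ge0 (phi k) x.
split.
  exact: (smoothing_dominates hcvg mF F0 FC Fsub).
exact: (smoothing_L2_density h0 hcvg mF F0 FC Favg Fsub).
Unshelve. all: by end_near. Qed.

End coded_measure.

(** * Almost every parameter *)

Section almost_every_parameter.
Variable R : realType.
Local Notation mu := (@lebesgue_measure R).

(** Fatou's lemma, applied to the majorants of the [F n] divided by [c n]. *)
Lemma ae_frequently_le (J : set R) (F : nat -> R -> R) (c : nat -> R) (D : R) :
  measurable J -> (forall n, 0 < c n) ->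
  (forall n, int_bounded J (F n) (D * c n)) ->
  mu.-negligible (J `&`
    [set l | ~ exists C, forall k, exists2 n, (k <= n)%N & F n l <= C * c n]).
Proof.
move=> mJ c0 /choice[H HP].
pose G n x := ((c n)^-1%:E * H n x)%E.
have mG n : measurable_fun J (G n) by have [mH _ _ _] := HP n; exact: measurable_funeM.
have G0 n x : J x -> (0 <= G n x)%E.
  have [_ H0 _ _] := HP n; move=> Jx.
  by rewrite mule_ge0 ?H0// lee_fin invr_ge0 ltW.
have GD n : (\int[mu]_(x in J) G n x <= D%:E)%E.
  have [mH H0 _ HD] := HP n; have cn := c0 n.
  rewrite ge0_integralZl ?lee_fin ?invr_ge0 ?(ltW cn)//.
  apply: (@le_trans _ _ ((c n)^-1%:E * (D * c n)%:E)%E).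
    by rewrite lee_wpmul2l ?lee_fin ?invr_ge0 ?(ltW cn).
  by rewrite -EFinM lee_fin mulrCA mulVf ?mulr1// gt_eqF.
have mlim : measurable_fun J (fun x => limn_einf (G ^~ x)).
  rewrite /limn_einf; apply: measurableT_comp => //.
  by apply: measurable_fun_limn_esup => k; apply: measurableT_comp => //; exact: mG.
have lim0 x : J x -> (0 <= limn_einf (G ^~ x))%E.
  by move=> Jx; apply: limn_einf_ge0 => n; exact: G0.
have intlim : mu.-integrable J (fun x => limn_einf (G ^~ x)).
  apply/integrableP; split => //.
  rewrite [X in (X < _)%E](_ : _ = \int[mu]_(x in J) limn_einf (G ^~ x))%E; last first.
    by apply: eq_integral => x /set_mem Jx; rewrite gee0_abs// lim0.
  apply: (@le_lt_trans _ _ D%:E); last exact: ltry.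
  apply: (@le_trans _ _ (limn_einf (fun k => \int[mu]_(x in J) G k x))%E).
    exact: fatou.
  exact: limn_einf_le_cst.
have := integrable_ae (mJ : measurable (J : set (measurableTypeR R))) intlim.
apply: negligibleS => l [Jl nC] /= fl; apply: nC.
have := fl Jl => lfin.
exists (fine (limn_einf (G ^~ l)) + 1) => k.
have [|n kn Gn] := @limn_einf_frequently _ (G ^~ l) (fine (limn_einf (G ^~ l)) + 1) _ k.
  by rewrite -[X in (X < _)%E](fineK lfin) lte_fin ltrDl.
exists n => //; have [_ _ FH _] := HP n.
have Hn : (H n l <= (c n)%:E * (fine (limn_einf (G ^~ l)) + 1)%:E)%E.
  by rewrite -lee_pdivrMl//; exact: ltW.
by have := le_trans (FH l Jl) Hn; rewrite -EFinM lee_fin mulrC.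
Qed.

(** Countably many intervals with rational end points suffice. *)
Lemma locally_negligible (N : set R) :
  (forall l, N l -> exists2 e, 0 < e & mu.-negligible (N `&` ball l e)) ->
  mu.-negligible N.
Proof.
move=> Nloc.
pose I (k : nat) : set R := if (unpickle k : option (rat * rat)) is Some ab
  then [set` `]ratr ab.1, ratr ab.2[ ] else set0.
pose F k := if `[< mu.-negligible (N `&` I k) >] then N `&` I k else set0.
have NF : N `<=` \bigcup_k F k.
  move=> l Nl; have [e e0 ne] := Nloc l Nl.
  have [a] := @rat_in_itvoo R (l - e) l ltac:(lra).
  have [b] := @rat_in_itvoo R l (l + e) ltac:(lra).
  rewrite !in_itv/= => /andP[lb be] /andP[ea al].
  have [k Ik] : exists k, I k = [set` `]ratr a, ratr b[ ].
    by exists (pickle (a, b)); rewrite /I pickleK.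
  exists k => //; rewrite /F asboolT Ik; first by split; rewrite //= in_itv/= al lb.
  apply: negligibleS ne; apply: setIS => x; rewrite /= in_itv/= /ball/= => /andP[ax xb].
  by rewrite ltr_norml; apply/andP; split; lra.
have : mu.-negligible (\bigcup_k F k); last by apply: negligibleS.
apply: negligible_bigcup => k; rewrite /F.
by case: asboolP => // _; exact: negligible_set0.
Qed.

Lemma lipschitz_of_derive1_bounded (g : R -> R) (u0 u1 B : R) :
  (forall l, l \in `]u0, u1[ -> derivable g l 1) ->
  (forall l, l \in `]u0, u1[ -> `|derive1 g l| <= B) ->
  forall l l', l \in `]u0, u1[ -> l' \in `]u0, u1[ -> `|g l - g l'| <= B * `|l - l'|.
Proof.
move=> dg gB l l'; wlog ll' : l l' / l <= l' => [th|].
  move=> Ul Ul'; case/orP: (le_total l l') => ll'; first exact: th.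
  by rewrite distrC [`|l - l'|]distrC; exact: th.
move=> Ul Ul'.
have sub z : z \in `[l, l'] -> z \in `]u0, u1[.
  move: Ul Ul'; rewrite !in_itv/= => /andP[h1 h2] /andP[h3 h4] /andP[h5 h6].
  by apply/andP; split; lra.
have [z||z zll gE] := @MVT_segment R g (fun z => derive1 g z) l l' ll'.
- move=> zll; rewrite derive1E; apply: DeriveDef => //; apply: dg; apply: sub.
  exact: subset_itv_oo_cc zll.
- by apply: derivable_within_continuous => z /sub; exact: dg.
- by rewrite distrC gE normrM [`|l - l'|]distrC ler_wpM2r// gB// sub.
Qed.

End almost_every_parameter.

(** * Families of self-similar systems *)

Section self_similar_family.
Variables (R : realType) (m : nat) (delta u0 u1 b0 b1 x0 : R).
Let U : set R := [set` `]u0, u1[ ].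
Let X : set R := [set` `[b0, b1] ].
Variables (r a : R -> 'I_m.+1 -> R).
Let f := fun l => affine_ifs (r l) (a l).
Local Notation mu := (@lebesgue_measure R).
Hypotheses (b01 : b1 - b0 = 1) (Xx0 : X x0).
Hypothesis r01 : forall l j, U l -> 0 < r l j < 1.
Hypothesis XX : forall l j x, U l -> X x -> X (f l j x).
Hypothesis fsmooth : smooth_parameter delta U X f.
Hypothesis delta0 : 0 <= delta.
Hypothesis u01 : u0 < u1.
Hypothesis trans : transversality U f x0.

Let Xb0 : X b0. Proof. by rewrite /X/= in_itv/= lexx/=; have := b01; lra. Qed.
Let Xb1 : X b1. Proof. by rewrite /X/= in_itv/= lexx andbT; have := b01; lra. Qed.

Let Xdiam x y : X x -> X y -> `|x - y| <= 1.
Proof.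
rewrite /X/= !in_itv/= => /andP[h1 h2] /andP[h3 h4].
by have b := b01; rewrite ler_norml; apply/andP; split; lra.
Qed.

(** The derivative in the parameter is Hoelder continuous on a bounded interval,
    hence bounded; as the maps are affine in [x], the end points of [X] decide. *)
Lemma parameter_lipschitz : exists2 K, 0 <= K &
  forall l l' j x, U l -> U l' -> X x -> `|f l j x - f l' j x| <= K * `|l - l'|.
Proof.
case: fsmooth => dif [C C0 hC].
pose c := (u0 + u1) / 2.
have Uc : U c by rewrite /U/= in_itv/= /c; have u := u01; apply/andP; split; lra.
pose B j x := `|d_l f c j x| + C * (u1 - u0) `^ delta.
have B0 j x : 0 <= B j x by rewrite addr_ge0// mulr_ge0 ?powR_ge0// ltW.
have lip j x : X x -> forall l l', U l -> U l' -> `|f l j x - f l' j x| <= B j x * `|l - l'|.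
  move=> Xx; apply: (@lipschitz_of_derive1_bounded R (fun k => f k j x) u0 u1 (B j x)).
    by move=> l lU; have [+ _] := dif j x Xx; apply.
  move=> l lU; have := hC l c j x lU Uc Xx => h.
  rewrite -/(d_l f l j x) -(subrK (d_l f c j x) (d_l f l j x)).
  rewrite (le_trans (ler_normD _ _))// addrC lerD2l (le_trans h)// ler_wpM2l ?(ltW C0)//.
  rewrite ge0_ler_powR// ?nnegrE ?subr_ge0 ?(ltW u01)//.
  move: lU; rewrite in_itv/= /c ler_norml => /andP[h1 h2]; apply/andP; split; lra.
pose K := \sum_j (B j b0 + B j b1).
have KB j : B j b0 + B j b1 <= K.
  rewrite /K (bigD1 j)//= lerDl; apply: sumr_ge0 => i _; exact: addr_ge0.
exists K; first by apply: sumr_ge0 => j _; exact: addr_ge0.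
move=> l l' j x Ul Ul' Xx.
have h0 := lip j b0 Xb0 l l' Ul Ul'; have h1 := lip j b1 Xb1 l l' Ul Ul'.
have -> : f l j x - f l' j x =
    (b1 - x) * (f l j b0 - f l' j b0) + (x - b0) * (f l j b1 - f l' j b1).
  have -> : f l j x - f l' j x = (b1 - b0) * (f l j x - f l' j x) by rewrite b01 mul1r.
  by rewrite /f /affine_ifs; ring.
move: (Xx); rewrite /X/= in_itv/= => /andP[x0' x1'].
have b := b01.
rewrite (le_trans (ler_normD _ _))// !normrM (ger0_norm (_ : 0 <= b1 - x)) ?subr_ge0//.
rewrite (ger0_norm (_ : 0 <= x - b0)) ?subr_ge0//.
have k0 : (b1 - x) * `|f l j b0 - f l' j b0| <= B j b0 * `|l - l'|.
  by rewrite (le_trans _ h0)// ler_piMl//; lra.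
have k1 : (x - b0) * `|f l j b1 - f l' j b1| <= B j b1 * `|l - l'|.
  by rewrite (le_trans _ h1)// ler_piMl//; lra.
rewrite (le_trans (lerD k0 k1))// -mulrDl ler_wpM2r//.
Qed.

Let p l j := r l j `^ sim_dim (r l).

Lemma natural_weight_lt l j : U l -> 1 < sim_dim (r l) -> 0 < p l j < r l j.
Proof.
move=> Ul s1; have /andP[r0 r1] := r01 j Ul.
rewrite /p powR_expR// expR_gt0/= -[ltRHS]lnK ?posrE// ltr_expR.
by rewrite gtr_nMl// ln_lt0// r0.
Qed.

(** With [s > 1] the similarity dimension, this sum is that of the
    [r l j `^ (2 * s - 1)], and [2 * s - 1 > s]. *)
Lemma energy_lt1 l : U l -> 1 < sim_dim (r l) ->
  0 < \sum_j p l j ^+ 2 / r l j < 1.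
Proof.
move=> Ul s1; have pr j := natural_weight_lt j Ul s1.
apply/andP; split.
  rewrite (bigD1 ord0)//= ltr_wpDr//.
    apply: sumr_ge0 => j _; rewrite divr_ge0 ?sqr_ge0//.
    by have /andP[r0 _] := r01 j Ul; exact: ltW.
  have /andP[p0 pr0] := pr ord0; rewrite divr_gt0 ?exprn_gt0//; exact: lt_trans pr0.
rewrite -[ltRHS](sim_dimP (fun j => r01 j Ul)).
apply: ltr_sum; first by apply/hasP; exists ord0; rewrite ?mem_index_enum.
move=> j _; have /andP[p0 pr0] := pr j.
rewrite expr2 -mulrA -[ltRHS]mulr1 ltr_pM2l// ltr_pdivrMr ?mul1r//; exact: lt_trans pr0.
Qed.

(** On a short enough interval around [l0], all the constants of [overlap_int]
    can be chosen uniformly: the bounds [rho] and [q] for the ratios, the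
    Lipschitz constant [L] of the logarithms of the weights, and the extreme
    values [pbar] and [rlow], which are within factors [expR th] and
    [expR (- th)] of their values at [l0], so close that the energy sum stays
    below 1. *)
Lemma local_density l0 : U l0 -> 1 < sim_dim (r l0) ->
  exists2 e, 0 < e & mu.-negligible (ball l0 e `&`
    [set l | ~ forall nu : set R -> \bar R, is_natural_measure (r l) (a l) x0 nu ->
      nu `<< mu /\ has_L2_density nu]).
Proof.
move=> Ul0 s1.
have [K K0 flip] := parameter_lipschitz.
have [eta eta0 tr] := trans.
have rlip l l' j : U l -> U l' -> `|r l j - r l' j| <= 2 * K * `|l - l'|.
  move=> Ul Ul'.
  have rE k : r k j = f k j b1 - f k j b0.
    by rewrite /f /affine_ifs -[LHS]mulr1 -b01; ring.
  have -> : r l j - r l' j = (f l j b1 - f l' j b1) - (f l j b0 - f l' j b0).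
    by rewrite !rE; ring.
  rewrite (le_trans (ler_normB _ _))//.
  have := flip l l' j b0 Ul Ul' Xb0; have := flip l l' j b1 Ul Ul' Xb1; lra.
have [rho0 [/andP[rho00 rho01] rho0r]] := exists_uniform_margin (fun j => r01 j Ul0).
have [|sig0 [/andP[sig00 sig01] sig0r]] := @exists_uniform_margin R _ (fun j => 1 - r l0 j).
  by move=> j; have /andP[h1 h2] := r01 j Ul0; apply/andP; split; lra.
pose rho := rho0 / 2; pose q := 1 - sig0 / 2.
have rhop : 0 < rho by rewrite divr_gt0.
have q0 : 0 < q by rewrite /q; lra.
have q1 : q < 1 by rewrite /q; lra.
have [M M0 Mlip] := natural_weight_lipschitz m q1 rhop.
pose L := M * (2 * K / rho).
have L0 : 0 <= L by rewrite mulr_ge0// divr_ge0 ?mulr_ge0// ltW.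
have /andP[kap0 kap1] := energy_lt1 Ul0 s1.
set kap := \sum_j _ in kap0 kap1.
pose th := - ln kap / 6.
have th0 : 0 < th by rewrite divr_gt0// oppr_gt0 ln_lt0// kap0.
(* The half-length [e] of the interval satisfies in turn: containment in [U]
   (twice), total length below 1, smallness for the separation lemma, the two
   bounds for the ratios, and the two bounds by [th]. *)
have [|e e0 /=] := @exists_small R [:: (1, l0 - u0); (1, u1 - l0); (2, 1);
  (4 * K / (1 - q), eta / 2); (2 * K, rho0 / 2); (2 * K, sig0 / 2);
  (L, th); (2 * K / rho, th)].
  have k4 : 0 <= 4 * K / (1 - q) by rewrite divr_ge0 ?mulr_ge0// subr_ge0 ltW.
  have k5 : 0 <= 2 * K by rewrite mulr_ge0.
  have k8 : 0 <= 2 * K / rho by rewrite divr_ge0// ltW.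
  move: (Ul0); rewrite /U/= in_itv/= !subr_gt0 => /andP[-> ->].
  by rewrite L0 th0 k4 k5 k8 !divr_gt0// ler01 ltr01 ler0n.
move=> /and5P[e1 e2 e3 e4] /and5P[e5 e6 e7 e8 _].
exists e => //.
pose J := ball l0 e.
have Jdist l : J l -> `|l - l0| < e by rewrite /J /ball/= distrC.
have JU : J `<=` U.
  move=> l /Jdist; rewrite /U/= in_itv/= ltr_norml => /andP[h1 h2].
  by rewrite mul1r in e1; rewrite mul1r in e2; apply/andP; split; lra.
have Jl0 : J l0 by exact: ballxx.
have mJ : measurable (J : set R) by exact: measurable_ball.
have muJ : (mu J <= 1%:E)%E.
  by rewrite /J lebesgue_measure_ball ?(ltW e0)// lee_fin -mulr_natl ltW.
have JJ l l' : J l -> J l' -> `|l - l'| <= 2 * e.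
  move=> /Jdist h1 /Jdist h2; have -> : l - l' = (l - l0) - (l' - l0) by ring.
  by rewrite (le_trans (ler_normB _ _))//; lra.
have rJ l j : J l -> rho <= r l j <= q.
  move=> Jl; have := rlip l l0 j (JU _ Jl) Ul0 => h.
  have h' : 2 * K * `|l - l0| <= 2 * K * e.
    by rewrite ler_wpM2l ?mulr_ge0// ltW// Jdist.
  have := rho0r j; have := sig0r j; move: h; rewrite ler_norml => /andP[h1 h2].
  by rewrite /rho /q => h3 h4; apply/andP; split; lra.
have lnr l l' j : J l -> J l' -> `|ln (r l j) - ln (r l' j)| <= 2 * K / rho * `|l - l'|.
  move=> Jl Jl'; have /andP[h1 _] := rJ l j Jl; have /andP[h2 _] := rJ l' j Jl'.
  rewrite (le_trans (ln_dist rhop h1 h2))// mulrAC ler_wpM2r ?invr_ge0 ?(ltW rhop)//.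
  by apply: rlip; exact: JU.
have plip l l' j : J l -> J l' -> p l j <= expR (L * `|l - l'|) * p l' j.
  move=> Jl Jl'; rewrite /L -mulrA.
  by apply: Mlip => i; [exact: rJ|exact: rJ|exact: lnr].
have p0 l j : J l -> 0 <= p l j by move=> _; exact: powR_ge0.
have p1 l : J l -> \sum_j p l j = 1.
  by move=> Jl; apply: sim_dimP => j; exact: r01 (JU _ Jl).
have rq l j : J l -> 0 <= r l j <= q.
  by move=> Jl; have /andP[h1 ->] := rJ l j Jl; rewrite (le_trans (ltW rhop) h1).
have XXJ l : J l -> forall j x, X x -> X (affine_ifs (r l) (a l) j x).
  by move=> Jl j x; apply: XX; exact: JU.
have Piq l w v : J l -> `|apply_word (r l) (a l) x0 (w ++ v) -
    apply_word (r l) (a l) x0 w| <= q ^+ size w.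
  move=> Jl; exact: (apply_word_prefix (fun j => rq l j Jl) Xdiam Xx0 (XXJ l Jl)).
have S0 : 0 <= 6 / eta by rewrite divr_ge0// ltW.
have sep n (w w' : seq 'I_m.+1) t l l' : (0 < n)%N -> size w = n -> size w' = n ->
  heads_differ w w' -> q ^+ n <= t -> J l -> J l' ->
  `|apply_word (r l) (a l) x0 w - apply_word (r l) (a l) x0 w'| <= t ->
  `|apply_word (r l') (a l') x0 w - apply_word (r l') (a l') x0 w'| <= t ->
  `|l - l'| <= 6 / eta * t.
  apply: (@transversal_separation R m U X J r a x0 q K (ltW q0) q1 K0 Xdiam Xx0 JU _ rq
    _ _ eta eta0 tr).
  - move=> x y z /Jdist; rewrite ltr_norml => /andP[x1 x2] /Jdist.
    rewrite ltr_norml => /andP[y1 y2] zxy.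
    rewrite /J /ball/= distrC ltr_norml.
    by case: (leP x y) zxy => _ /andP[z1 z2]; apply/andP; split; lra.
  - by move=> k j x Jk; apply: XX; exact: JU.
  - by move=> k k' j x Jk Jk'; apply: flip; exact: JU.
  - move=> k k' Jk Jk'; have kk := JJ k k' Jk Jk'; split; first by lra.
    apply: le_lt_trans e4.
    have q10 : 0 < 1 - q by rewrite subr_gt0.
    have -> : 4 * K / (1 - q) * e = 2 * (K * (2 * e) / (1 - q)) by field; rewrite gt_eqF.
    by rewrite ler_pM2l// ler_wpM2r ?invr_ge0 ?(ltW q10)// ler_wpM2l.
pose pbar j := expR th * p l0 j.
pose rlow j := expR (- th) * r l0 j.
have ppbar l j : J l -> p l j <= pbar j.
  move=> Jl; rewrite (le_trans (plip l l0 j Jl Jl0))// ler_wpM2r ?p0// ler_expR.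
  by rewrite (le_trans _ (ltW e7))// ler_wpM2l// ltW// Jdist.
have rlowr l j : J l -> 0 < rlow j <= r l j.
  move=> Jl; have /andP[rl _] := rJ l j Jl; have /andP[rl0 _] := rJ l0 j Jl0.
  have r0 := lt_le_trans rhop rl; have r00 := lt_le_trans rhop rl0.
  rewrite /rlow mulr_gt0 ?expR_gt0//=.
  rewrite -[leRHS]lnK ?posrE// -[in leLHS](@lnK _ (r l0 j)) ?posrE// -expRD ler_expR.
  have := lnr l l0 j Jl Jl0; rewrite ler_norml => /andP[h1 h2].
  have h3 : 2 * K / rho * `|l - l0| <= 2 * K / rho * e.
    by rewrite ler_wpM2l ?divr_ge0 ?mulr_ge0 ?(ltW rhop)// ltW// Jdist.
  lra.
have kappa1 : \sum_j pbar j ^+ 2 / rlow j < 1.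
  have -> : \sum_j pbar j ^+ 2 / rlow j = expR (3 * th) * kap.
    rewrite /kap mulr_sumr; apply: eq_bigr => j _.
    rewrite /pbar /rlow exprMn invfM expRN invrK -expRM_natl.
    have -> : 3 * th = 2%:R * th + th by ring.
    by rewrite expRD; ring.
  rewrite -[kap in X in X < _](@lnK _ kap) ?posrE// -expRD -[ltRHS]expR0 ltr_expR /th.
  have : ln kap < 0 by rewrite ln_lt0// kap0.
  lra.
have rq' l j : J l -> r l j <= q by move=> /(rq l j)/andP[].
have [D hD] := overlap_int mJ muJ Jl0 p0 p1 q0 q1 L0 S0 Piq plip sep ppbar rlowr rq' kappa1.
have h4 n : int_bounded J (fun l => overlap (r l) (a l) (p l) x0 n (4 * q ^+ n)) ((D * 4) * q ^+ n).
  by rewrite -mulrA; apply: hD; rewrite ler_peMl ?exprn_ge0 ?(ltW q0)//; lra.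
have := @ae_frequently_le R J _ (fun n => q ^+ n) _ mJ (fun n => exprn_gt0 n q0) h4.
apply: negligibleS => l [Jl nl]; split => // -[C hC]; apply: nl => nu [P PB ->].
exact: (overlap_L2_density (fun j => rq l j Jl) q0 q1 Xdiam Xx0 (XXJ l Jl)
  (fun j => p0 l j Jl) PB hC).
Qed.

End self_similar_family.

Theorem corollary10p4 (R : realType) (m : nat) (delta u0 u1 b0 b1 x0 : R)
    (U := [set` `]u0, u1[ ]) (X := [set` `[b0, b1] ])
    (r a : R -> 'I_m.+1 -> R) (f := fun l => affine_ifs (r l) (a l)) :
  0 < delta <= 1 -> u0 < u1 -> b1 - b0 = 1 -> X x0 ->
  (forall (l : R) (j : 'I_m.+1), closure U l -> 0 < r l j < 1) ->
  (forall (l : R) (j : 'I_m.+1) (x : R), closure U l -> X x -> X (f l j x)) ->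
  (forall l : R, closure U l -> distinct_fixpoints (f l)) ->
  smooth_space delta U X f ->
  smooth_parameter delta U X f ->
  smooth_mixed delta U X f ->
  hyperbolic U X f ->
  transversality U f x0 ->
  {ae lebesgue_measure, forall l : R, U l -> 1 < sim_dim (r l) ->
    forall nu : set R -> \bar R, is_natural_measure (r l) (a l) x0 nu ->
      nu `<< lebesgue_measure /\ has_L2_density nu}.
Proof.
move=> /andP[delta0 _] u01 b01 Xx0 r01 XX _ _ fsmooth _ _ tr.
apply: locally_negligible => l0 /= nl0.
have [Ul0 s0] : U l0 /\ 1 < sim_dim (r l0).
  by split; apply: contrapT => nh; apply: nl0 => Ul0 s0.
have subU l : U l -> closure U l by exact: subset_closure.
have [e e0 ne] := local_density b01 Xx0 (fun l j Ul => r01 l j (subU l Ul))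
  (fun l j x Ul => XX l j x (subU l Ul)) fsmooth (ltW delta0) u01 tr Ul0 s0.
exists e => //; apply: negligibleS ne => l [nl Jl]; split => // dens.
by apply: nl => _ _; exact: dens.
Qed.
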